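(* Let $\omega>0$, let $a:[0,\infty)\to\mathbb{R}$ be locally absolutely continuous and $b:[0,\infty)\to\mathbb{R}$ be Lebesgue measurable and essentially bounded, both $\omega$-periodic: $a(t+\omega)=a(t)$, $b(t+\omega)=b(t)$. Assume that the equation $$\ddot x(t)+a(t)\dot x(t)+b(t)x(t)=0,\qquad t\in[0,\infty),$$ is oscillatory and that the distance between zeros of its solutions is different from $2\omega$ (i.e. no nontrivial solution has two zeros, adjacent or not, at distance exactly $2\omega$). Then: a) If $\int_0^\omega a(t)\,dt>0$, the equation is exponentially stable. b) If $\int_0^\omega a(t)\,dt<0$, the equation has a fundamental pair of solutions of the form $$y_1(t)=\left(g_1(t)\cos\frac{\theta t}{\omega}-g_2(t)\sin\frac{\theta t}{\omega}\right)\exp\left(\frac{\ln|\lambda_1|}{\omega}t\right),$$ $$y_2(t)=\left(g_2(t)\cos\frac{\theta t}{\omega}+g_1(t)\sin\frac{\theta t}{\omega}\right)\exp\left(\frac{\ln|\lambda_1|}{\omega}t\right),$$ with $\omega$-periodic functions $g_1,g_2$, where $\lambda_1=|\lambda_1|e^{i\theta}$ is a root of the characteristic equation $\lambda^2-(x_1(\omega)+x_2'(\omega))\lambda+W(\omega)=0$ and $|\lambda_1|>1$. c) If $\int_0^\omega a(t)\,dt=0$, the fundamental solutions of the equation are bounded.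
   Context: A solution is a function with locally absolutely continuous derivative satisfying the equation almost everywhere. The equation is oscillatory if every nontrivial solution has arbitrarily large zeros. $x_1,x_2$ are the solutions with $x_1(0)=1,x_1'(0)=0$, $x_2(0)=0,x_2'(0)=1$, and $W(t)=x_1(t)x_2'(t)-x_1'(t)x_2(t)$ is their Wronskian. The fundamental function $X(t,s)$: for each $s\ge0$, $X(\cdot,s)$ is the solution on $t\ge s$ with $x(s)=0$, $\dot x(s)=1$. The equation is called exponentially stable if there exist $K>0,\lambda>0$ such that $|X(t,s)|\le K e^{-\lambda(t-s)}$ for all $t\ge s\ge 0$. *)

(* Defs.v *)
From mathcomp Require Import all_boot all_order all_algebra.
From mathcomp Require Import all_classical all_reals all_analysis.
From mathcomp Require Import complex.

Set Implicit Arguments.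
Unset Strict Implicit.
Unset Printing Implicit Defensive.

Import Order.TTheory GRing.Theory Num.Theory.
Import numFieldNormedType.Exports.

Local Open Scope classical_set_scope.
Local Open Scope ring_scope.

(* A function on [s, +oo[ is encoded as a total function R -> R; every notion
   below depends only on its restriction to [s, +oo[. *)

Definition abs_continuous_on (R : realType) (c d : R) (f : R -> R) : Prop :=
  forall e : R, 0 < e -> exists delta : R, 0 < delta /\
    forall (n : nat) (u v : 'I_n -> R),
      (forall i, [/\ c <= u i, u i <= v i & v i <= d]) ->
      trivIset [set: 'I_n] (fun i => `]u i, v i[%classic) ->
      \sum_(i < n) (v i - u i) < delta ->
      \sum_(i < n) `|f (v i) - f (u i)| < e.

Definition loc_abs_continuous (R : realType) (s : R) (f : R -> R) : Prop :=
  forall c d : R, s <= c -> c <= d -> abs_continuous_on c d f.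

(* Measurability with respect to the (complete) Lebesgue sigma-algebra, the
   domain of [completed_lebesgue_measure]; [measurable_fun] on R itself would
   only mean Borel measurability. *)
Definition lebesgue_measurable_fun (R : realType) (A : set R) (f : R -> R) :
    Prop :=
  measurable_fun
    (A : set (caratheodory_type ((@wlength R idfun)^*)%mu)) f.

Definition ess_bounded (R : realType) (f : R -> R) : Prop :=
  exists M : R, {ae (@lebesgue_measure R), forall t, 0 <= t -> `|f t| <= M}.

Definition periodic_halfline (R : realType) (omega : R) (f : R -> R) : Prop :=
  forall t : R, 0 <= t -> f (t + omega) = f t.

(* Difference quotients at t are taken inside [s, +oo[, so that the derivative
   is one-sided at t = s and the usual one for t > s. *)
Definition diff_quot (R : realType) (x : R -> R) (t : R) : R -> R :=
  fun y => (x y - x t) / (y - t).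

Definition derivable_halfline (R : realType) (s : R) (x : R -> R) (t : R) :
    Prop :=
  cvg (diff_quot x t @ within `[s, +oo[%classic t^').

Definition deriv_halfline (R : realType) (s : R) (x : R -> R) (t : R) : R :=
  lim (diff_quot x t @ within `[s, +oo[%classic t^').

Definition is_solution (R : realType) (a b : R -> R) (s : R) (x : R -> R) :
    Prop :=
  let x' := deriv_halfline s x in
  [/\ forall t, s <= t -> derivable_halfline s x t,
      loc_abs_continuous s x' &
      {ae (@lebesgue_measure R), forall t, s < t ->
         derivable x' t 1 /\ 'D_1 x' t + a t * x' t + b t * x t = 0}].

Definition nontrivial (R : realType) (x : R -> R) : Prop :=
  exists t : R, 0 <= t /\ x t <> 0.

Definition oscillatory (R : realType) (a b : R -> R) : Prop :=
  forall x : R -> R, is_solution a b 0 x -> nontrivial x ->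
  forall T : R, exists t : R, [/\ 0 <= t, T <= t & x t = 0].

Definition no_zeros_at_distance (R : realType) (a b : R -> R) (d : R) : Prop :=
  forall x : R -> R, is_solution a b 0 x -> nontrivial x ->
  forall t1 t2 : R, 0 <= t1 -> 0 <= t2 -> x t1 = 0 -> x t2 = 0 ->
  t2 - t1 <> d.

(* X t s is X(t, s); only its values for t >= s >= 0 matter. *)
Definition is_fundamental_function (R : realType) (a b : R -> R)
    (X : R -> R -> R) : Prop :=
  forall s : R, 0 <= s ->
  [/\ is_solution a b s (X ^~ s), X s s = 0 &
      deriv_halfline s (X ^~ s) s = 1].

Definition exponentially_stable (R : realType) (a b : R -> R) : Prop :=
  exists X : R -> R -> R, is_fundamental_function a b X /\
  exists K lambda : R, [/\ 0 < K, 0 < lambda &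
    forall t s : R, 0 <= s -> s <= t ->
      `|X t s| <= K * expR (- lambda * (t - s))].

Definition fundamental_pair (R : realType) (a b y1 y2 : R -> R) : Prop :=
  [/\ is_solution a b 0 y1, is_solution a b 0 y2 &
      forall c1 c2 : R,
        (forall t : R, 0 <= t -> c1 * y1 t + c2 * y2 t = 0) ->
        c1 = 0 /\ c2 = 0].

Definition bounded_halfline (R : realType) (y : R -> R) : Prop :=
  exists M : R, forall t : R, 0 <= t -> `|y t| <= M.

Definition solution_with_init (R : realType) (a b : R -> R) (p q : R)
    (x : R -> R) : Prop :=
  [/\ is_solution a b 0 x, x 0 = p & deriv_halfline 0 x 0 = q].

Definition wronskian (R : realType) (x1 x2 : R -> R) (t : R) : R :=
  x1 t * deriv_halfline 0 x2 t - deriv_halfline 0 x1 t * x2 t.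

Local Open Scope complex_scope.

Definition characteristic_root (R : realType) (a b : R -> R) (omega : R)
    (lambda : R[i]) : Prop :=
  exists x1 x2 : R -> R,
  [/\ solution_with_init a b 1 0 x1, solution_with_init a b 0 1 x2 &
      lambda ^+ 2 - (x1 omega + deriv_halfline 0 x2 omega)%:C * lambda
        + (wronskian x1 x2 omega)%:C = 0].

(* The modulus as a real number; the norm of R[i] takes values in R[i]. *)
Definition modulus (R : realType) (z : R[i]) : R := ComplexField.Normc.normc z.

Definition cexp_i (R : realType) (theta : R) : R[i] :=
  cos theta +i* sin theta.

(* Main.v *)
(** In the basis x1, x2 the shift by omega acts on solutions as the monodromy
    matrix, whose determinant W(omega) is exp(- int_0^omega a) by Liouville's
    formula. If l is a real eigenvalue, its eigensolution satisfies
    x(t + 2 omega) = l^2 x(t), and having a zero by oscillation it has two zeros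
    at distance 2 omega, which is excluded. So the eigenvalues are conjugate
    complex numbers of squared modulus W(omega); the complex eigensolution times
    W(omega)^(- t / (2 omega)) has periodic modulus, and the sign of the integral
    of a decides between decay, growth and boundedness.

    Uniqueness, Liouville's formula and the identification of solutions all rest
    on the fact that an absolutely continuous function with derivative zero
    almost everywhere is constant. Existence is by Picard iteration in a weighted
    supremum norm, after replacing b by a bounded Borel function equal to it
    almost everywhere. *)

Require Import Defs.
From mathcomp Require Import all_boot all_order all_algebra.
From mathcomp Require Import all_classical all_reals all_analysis.
From mathcomp Require Import complex.
From mathcomp Require Import ring lra.

Set Implicit Arguments.
Unset Strict Implicit.
Unset Printing Implicit Defensive.

Import Order.TTheory GRing.Theory Num.Theory.
Import numFieldNormedType.Exports.

Local Open Scope classical_set_scope.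
Local Open Scope ring_scope.
Local Open Scope complex_scope.


(** A solution is handled as a pair (x, v) with v = x', and derivatives are stated without
    quotients, so that y = t is no exception and slope estimates add up along an interval.
    Boundedness of continuous functions, the mean value inequality and the constancy principle all
    come from one induction on intervals, [cousin].

    Uniqueness needs no Gronwall estimate: a difference of solutions with zero initial data has zero
    Wronskian with two independent solutions, hence vanishes.

    For stability, decay of each solution is not enough, since K must not depend on s. The proof
    uses X(t, s) = (y1(s) y2(t) - y2(s) y1(t)) / W(s), with W the Wronskian of y1, y2. If kappa is
    the mean of [a], the numerator is of order exp(- kappa (s + t) / 2) and 1 / W(s) of order
    exp(kappa s), which leaves exp(- kappa (t - s) / 2). *)

Definition halfline_derivative (R : realType) (s : R) (f : R -> R) (t l : R) : Prop :=
  forall e : R, 0 < e -> exists2 d : R, 0 < d &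
    forall y, s <= y -> `|y - t| < d -> `|f y - f t - l * (y - t)| <= e * `|y - t|.

(** * One-sided derivatives *)

Section HalflineDerivative.
Context {R : realType}.
Implicit Types (s t l m c : R) (f g : R -> R).

Lemma within_dnbhs_near s t (P : R -> Prop) :
  (\forall y \near within `[s, +oo[%classic t^', P y) <->
  exists2 d : R, 0 < d & forall y, s <= y -> y != t -> `|y - t| < d -> P y.
Proof.
rewrite /within /dnbhs /= /within /=; split.
- move=> /nbhs_ballP [d /= d0 H]; exists d => // y sy yt ytd.
  apply: (H y _ yt); last by rewrite /= in_itv /= sy.
  by rewrite /ball /= distrC.
- move=> [d d0 H]; apply/nbhs_ballP; exists d => //= y; rewrite /ball /= distrC => ytd yt.
  rewrite in_itv /= andbT => sy; exact: H.
Qed.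

(** Properness makes [deriv_halfline] the only possible limit. Points to the right of t are always
    available, even at t = s. *)
Lemma halfline_dnbhs_proper s t : s <= t -> ProperFilter (within `[s, +oo[%classic t^').
Proof.
move=> st; apply: Build_ProperFilter_ex => P /within_dnbhs_near [d d0 H].
exists (t + d / 2); apply: H; first by lra.
- by apply/eqP; lra.
- by rewrite addrAC subrr add0r gtr0_norm; lra.
Qed.

Lemma halfline_derivative_cvg s f t l :
  halfline_derivative s f t l <->
  diff_quot f t @ within `[s, +oo[%classic t^' --> l.
Proof.
split.
- move=> H; apply/cvgrPdist_le => e e0.
  apply/within_dnbhs_near; have [d d0 Hd] := H e e0; exists d => // y sy yt yd.
  have yt0 : y - t != 0 by rewrite subr_eq0.
  rewrite distrC /diff_quot.
  have -> : (f y - f t) / (y - t) - l = (f y - f t - l * (y - t)) / (y - t) by field.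
  by rewrite normrM normfV ler_pdivrMr ?normr_gt0 //; exact: Hd.
- move=> /cvgrPdist_le H e e0.
  have /within_dnbhs_near [d d0 Hd] := H e e0; exists d => // y sy yd.
  have [->|yt] := eqVneq y t; first by rewrite !subrr mulr0 subr0 normr0 mulr0.
  have yt0 : y - t != 0 by rewrite subr_eq0.
  have := Hd y sy yt yd; rewrite distrC /diff_quot.
  have -> : (f y - f t) / (y - t) - l = (f y - f t - l * (y - t)) / (y - t) by field.
  by rewrite normrM normfV ler_pdivrMr ?normr_gt0.
Qed.

Lemma halfline_derivative_deriv s f t l : s <= t ->
  halfline_derivative s f t l -> deriv_halfline s f t = l.
Proof.
move=> st /halfline_derivative_cvg H; have ? := halfline_dnbhs_proper st.
exact: cvg_lim H.
Qed.

Lemma halfline_derivative_derivable s f t l :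
  halfline_derivative s f t l -> derivable_halfline s f t.
Proof. by move=> /halfline_derivative_cvg H; apply/cvg_ex; exists l. Qed.

Lemma derivable_halflineP s f t :
  derivable_halfline s f t -> halfline_derivative s f t (deriv_halfline s f t).
Proof. by move=> H; apply/halfline_derivative_cvg. Qed.

Lemma halfline_derivativeS s s' f t l : s <= s' ->
  halfline_derivative s f t l -> halfline_derivative s' f t l.
Proof.
move=> ss H e /H [d d0 Hd]; exists d => // y sy; apply: Hd; exact: le_trans sy.
Qed.

Lemma halfline_derivativeD s f g t l m : halfline_derivative s f t l ->
  halfline_derivative s g t m -> halfline_derivative s (fun y => f y + g y) t (l + m).
Proof.
move=> Hf Hg e e0; have e20 : 0 < e / 2 by lra.
have [d d0 Hd] := Hf _ e20; have [d' d'0 Hd'] := Hg _ e20.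
exists (Num.min d d'); first by rewrite lt_min d0.
move=> y sy; rewrite lt_min => /andP[yd yd'].
have -> : f y + g y - (f t + g t) - (l + m) * (y - t) =
  (f y - f t - l * (y - t)) + (g y - g t - m * (y - t)) by ring.
apply: le_trans (ler_normD _ _) _.
have -> : e * `|y - t| = e / 2 * `|y - t| + e / 2 * `|y - t| by field.
by apply: lerD; [exact: Hd|exact: Hd'].
Qed.

Lemma halfline_derivativeZ s f t l c : halfline_derivative s f t l ->
  halfline_derivative s (fun y => c * f y) t (c * l).
Proof.
move=> Hf e e0; have c0 : 0 < `|c| + 1 by rewrite ltr_wpDl.
have [d d0 Hd] := Hf _ (divr_gt0 e0 c0); exists d => // y sy yd.
have -> : c * f y - c * f t - c * l * (y - t) = c * (f y - f t - l * (y - t)) by ring.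
rewrite normrM; apply: (@le_trans _ _ ((`|c| + 1) * (e / (`|c| + 1) * `|y - t|))).
  by apply: ler_pM => //; [lra|exact: Hd].
by rewrite mulrA mulrCA divff ?mulr1 // gt_eqF.
Qed.

Lemma halfline_derivative_comp_shift s f t l c : halfline_derivative s f (t + c) l ->
  0 <= c -> halfline_derivative s (fun y => f (y + c)) t l.
Proof.
move=> Hf c0 e /Hf [d d0 Hd]; exists d => // y sy yd.
have E : y - t = y + c - (t + c) by ring.
rewrite E in yd *; apply: Hd => //; lra.
Qed.

Lemma is_deriveP f t l : is_derive t 1 f l <->
  forall e : R, 0 < e -> exists2 d : R, 0 < d &
    forall y, `|y - t| < d -> `|f y - f t - l * (y - t)| <= e * `|y - t|.
Proof.
split.
- move=> [/cvg_ex [k Hk] fl].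
  have {fl}kl : k = l by rewrite -fl; apply/esym/cvg_lim.
  rewrite kl in Hk => {k kl}.
  move=> e e0; move/cvgrPdist_le : Hk => /(_ e e0) /nbhs_ballP [d /= d0 Hd].
  exists d => // y yd.
  have [->|yt] := eqVneq y t; first by rewrite !subrr mulr0 subr0 normr0 mulr0.
  have yt0 : y - t != 0 by rewrite subr_eq0.
  have /= := Hd (y - t); rewrite /ball /= sub0r normrN => /(_ yd yt0).
  rewrite /GRing.scale /= mulr1 subrK distrC.
  have -> : (y - t)^-1 * (f y - f t) - l = (f y - f t - l * (y - t)) / (y - t) by field.
  by rewrite normrM normfV ler_pdivrMr ?normr_gt0.
- move=> H.
  have Hc : h^-1 *: (f (h *: (1 : R^o) + t) - f t) @[h --> 0^'] --> (l : R^o).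
    apply/cvgrPdist_le => e e0; have [d d0 Hd] := H e e0.
    apply/nbhs_ballP; exists d => //= h; rewrite /ball /= sub0r normrN => hd h0.
    rewrite distrC /GRing.scale /= mulr1.
    have := Hd (h + t); rewrite addrK => /(_ hd).
    have -> : h^-1 * (f (h + t) - f t) - l = (f (h + t) - f t - l * h) / h by field.
    by rewrite normrM normfV ler_pdivrMr ?normr_gt0.
  by split; [apply/cvg_ex; exists l|apply/cvg_lim].
Qed.

Lemma halfline_derivative_is_derive s f t l : s < t ->
  halfline_derivative s f t l <-> is_derive t 1 f l.
Proof.
move=> st; rewrite is_deriveP; split.
- move=> H e /H [d d0 Hd]; exists (Num.min d (t - s)); first by rewrite lt_min d0 subr_gt0.
  move=> y; rewrite lt_min => /andP[yd]; rewrite ltr_norml => /andP[ys _].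
  by apply: Hd => //; lra.
- by move=> H e /H [d d0 Hd]; exists d => // y _; exact: Hd.
Qed.

End HalflineDerivative.

(** * Absolute continuity *)

Section AbsoluteContinuity.
Context {R : realType}.
Implicit Types (c d : R) (f g : R -> R).
Notation mu := (@lebesgue_measure R).

(** Cousin's lemma as an induction principle: a property of intervals that passes to adjacent unions
    and holds for all small intervals around each tag t holds for [c, d]. It stands in for
    compactness; the proof takes the supremum of the x with P c x. *)
Lemma cousin c d (P : R -> R -> Prop) : c <= d ->
  (forall x y z, c <= x -> x <= y -> y <= z -> z <= d -> P x y -> P y z -> P x z) ->
  (forall t, c <= t -> t <= d -> exists2 e : R, 0 < e & forall u v,
     c <= u -> u <= t -> t <= v -> v <= d -> t - u < e -> v - t < e -> P u v) ->
  P c d.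
Proof.
move=> cd Ptrans Ploc.
pose E := [set x | [/\ c <= x, x <= d & P c x]].
have Ec : E c.
  by split => //; have [e e0] := Ploc c (lexx _) cd; apply => //; rewrite subrr.
have supE : has_sup E by split; [exists c|exists d => x []].
have cs : c <= sup E by apply: ub_le_sup Ec; case: supE.
have sd : sup E <= d by apply: ge_sup; [exists c|move=> x []].
have [e e0 He] := Ploc _ cs sd.
have [x [cx xd Pcx] sx] := sup_adherent e0 supE.
have xs : x <= sup E by apply: ub_le_sup; [case: supE|].
(* A step beyond the supremum, cut off at d: it belongs to [E], which is contradictory unless the
   cut-off took place. *)
pose v := Num.min d (sup E + e / 2).
have vd : v <= d by rewrite ge_min lexx.
have sv : sup E <= v by rewrite le_min sd /=; lra.
have Pcv : P c v.
  apply: (Ptrans c x v) => //; first by exact: le_trans sv.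
  apply: He => //; first by lra.
  have : v <= sup E + e / 2 by rewrite ge_min lexx orbT.
  lra.
have : v <= sup E.
  by apply: ub_le_sup; [case: supE|split => //; exact: le_trans sv].
rewrite ge_min => /orP[ds|]; last by lra.
suff -> : d = v by [].
by apply/le_anti; rewrite vd andbT (le_trans ds).
Qed.

Definition continuous_on c d f := forall t, c <= t -> t <= d ->
  forall e : R, 0 < e -> exists2 r : R, 0 < r &
    forall y, c <= y -> y <= d -> `|y - t| < r -> `|f y - f t| < e.

Lemma continuous_on_bounded c d f : c <= d -> continuous_on c d f ->
  exists2 M, 0 < M & forall t, c <= t -> t <= d -> `|f t| <= M.
Proof.
move=> cd Hf.
pose P (x y : R) := exists2 M, 0 < M & forall t, x <= t -> t <= y -> `|f t| <= M.
apply: (@cousin c d P cd).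
- move=> x y z cx xy yz zd [M M0 HM] [N N0 HN]; exists (Num.max M N).
    by rewrite lt_max M0.
  move=> t xt tz; rewrite le_max; have [ty|yt] := leP t y.
    by rewrite HM.
  by rewrite HN ?orbT // ltW.
- move=> t ct td; have [r r0 Hr] := Hf t ct td 1 ltr01; exists r => // u v cu ut tv vd tu vt.
  exists (`|f t| + 1); first by rewrite ltr_wpDl.
  move=> y uy yv.
  have yr : `|y - t| < r by rewrite ltr_norml; apply/andP; split; lra.
  have := Hr y (le_trans cu uy) (le_trans yv vd) yr.
  rewrite -{2}(subrKC (f t) (f y)).
  by move=> H; apply: le_trans (ler_normD _ _) _; rewrite lerD2l ltW.
Qed.

(** The mean value inequality by [cousin]: near a tag t the increment over [u, v] splits at t into
    two increments of slope at most M + k. *)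
Lemma halfline_derivative_lipschitz c d f f' M : c <= d ->
  (forall t, c <= t -> t <= d -> halfline_derivative c f t (f' t) /\ `|f' t| <= M) ->
  `|f d - f c| <= M * (d - c).
Proof.
move=> cd Hf; apply/ler_addgt0Pr => e e0.
(* An extra slope of k costs at most e over [c, d]; the summand 1 keeps the denominator positive
   when c = d. *)
have k0 : 0 < e / (d - c + 1) by rewrite divr_gt0 //; lra.
set k := e / (d - c + 1) in k0.
have kE : k * (d - c) <= e.
  rewrite /k mulrAC ler_pdivrMr; last by lra.
  by rewrite ler_pM2l //; lra.
have : `|f d - f c| <= (M + k) * (d - c).
  apply: (@cousin c d (fun x y => `|f y - f x| <= (M + k) * (y - x)) cd).
  - move=> x y z _ _ _ _ H1 H2.
    have -> : f z - f x = (f z - f y) + (f y - f x) by ring.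
    apply: le_trans (ler_normD _ _) _.
    have -> : (M + k) * (z - x) = (M + k) * (z - y) + (M + k) * (y - x) by ring.
    exact: lerD.
  - move=> t ct td; have [H1 H2] := Hf t ct td; have [r r0 Hr] := H1 _ k0.
    exists r => // u v cu ut tv vd tu vt.
    have H y : c <= y -> `|y - t| < r -> `|f y - f t| <= (M + k) * `|y - t|.
      move=> cy yr; have -> : f y - f t = (f y - f t - f' t * (y - t)) + f' t * (y - t) by ring.
      apply: le_trans (ler_normD _ _) _; rewrite normrM mulrDl addrC.
      by apply: lerD; [rewrite ler_wpM2r|exact: Hr].
    have ut' : `|u - t| = t - u by rewrite distrC ger0_norm // subr_ge0.
    have vt' : `|v - t| = v - t by rewrite ger0_norm // subr_ge0.
    have := H u cu; rewrite ut' => /(_ tu) Hu.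
    have := H v (le_trans ct tv); rewrite vt' => /(_ vt) Hv.
    have -> : f v - f u = (f v - f t) - (f u - f t) by ring.
    apply: le_trans (ler_normB _ _) _; apply: le_trans (lerD Hv Hu) _; lra.
by move=> /le_trans; apply; rewrite mulrDl lerD2l.
Qed.

Lemma abs_continuous_continuous c d f : abs_continuous_on c d f -> continuous_on c d f.
Proof.
move=> Hf t ct td e e0; have [r [r0 Hr]] := Hf e e0; exists r => // y cy yd yr.
have H u v : c <= u -> u <= v -> v <= d -> v - u < r -> `|f v - f u| < e.
  move=> cu uv vd vu.
  have := Hr 1%N (fun=> u) (fun=> v); rewrite !big_ord1; apply => //.
  by move=> i j _ _ _; rewrite !ord1.
have [ty|yt] := leP t y.
  by apply: H => //; rewrite -(ger0_norm (_ : 0 <= y - t)) // subr_ge0.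
rewrite distrC; apply: H => //; first exact: ltW.
by rewrite -(ger0_norm (_ : 0 <= t - y)) 1?distrC // subr_ge0 ltW.
Qed.

Lemma lipschitz_abs_continuous c d f M :
  (forall u v, c <= u -> u <= v -> v <= d -> `|f v - f u| <= M * (v - u)) ->
  abs_continuous_on c d f.
Proof.
move=> Hf e e0; have M0 : 0 < `|M| + 1 by rewrite ltr_wpDl.
exists (e / (`|M| + 1)); split; first exact: divr_gt0.
move=> n u v uv _; rewrite ltr_pdivlMr // => H.
apply: le_lt_trans H; rewrite mulr_suml; apply: ler_sum => i _.
have [cu uv' vd] := uv i; apply: le_trans (Hf _ _ cu uv' vd) _.
rewrite mulrC ler_wpM2l ?subr_ge0 //.
by apply: le_trans (ler_norm _) _; rewrite lerDl.
Qed.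

Lemma abs_continuousM c d f g : c <= d -> abs_continuous_on c d f ->
  abs_continuous_on c d g -> abs_continuous_on c d (fun t => f t * g t).
Proof.
move=> cd Hf Hg.
have [M M0 HM] := continuous_on_bounded cd (abs_continuous_continuous Hf).
have [N N0 HN] := continuous_on_bounded cd (abs_continuous_continuous Hg).
move=> e e0.
have eN : 0 < e / 2 / N by rewrite !divr_gt0.
have eM : 0 < e / 2 / M by rewrite !divr_gt0.
have [r [r0 Hr]] := Hf _ eN; have [s [s0 Hs]] := Hg _ eM.
exists (Num.min r s); split; first by rewrite lt_min r0.
move=> n u v uv tr; rewrite lt_min => /andP[lr ls].
have := Hr n u v uv tr lr; have := Hs n u v uv tr ls.
rewrite !ltr_pdivlMr // => H1 H2.
apply: (@le_lt_trans _ _ ((\sum_(i < n) `|f (v i) - f (u i)|) * N +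
   (\sum_(i < n) `|g (v i) - g (u i)|) * M)); last by lra.
rewrite !mulr_suml -big_split /=; apply: ler_sum => i _.
have [cu uv' vd] := uv i.
have -> : f (v i) * g (v i) - f (u i) * g (u i) =
  (f (v i) - f (u i)) * g (v i) + (g (v i) - g (u i)) * f (u i) by ring.
apply: le_trans (ler_normD _ _) _; rewrite !normrM.
apply: lerD; apply: ler_wpM2l => //; [apply: HN|apply: HM] => //; exact: le_trans uv' _ || lra.
Qed.

Lemma abs_continuousD c d f g : abs_continuous_on c d f ->
  abs_continuous_on c d g -> abs_continuous_on c d (fun t => f t + g t).
Proof.
move=> Hf Hg e e0; have e2 : 0 < e / 2 by lra.
have [r [r0 Hr]] := Hf _ e2; have [s [s0 Hs]] := Hg _ e2.
exists (Num.min r s); split; first by rewrite lt_min r0.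
move=> n u v uv tr; rewrite lt_min => /andP[lr ls].
have H1 := Hr n u v uv tr lr; have H2 := Hs n u v uv tr ls.
apply: (@le_lt_trans _ _ ((\sum_(i < n) `|f (v i) - f (u i)|) +
   (\sum_(i < n) `|g (v i) - g (u i)|))); last by lra.
rewrite -big_split /=; apply: ler_sum => i _.
by rewrite opprD addrACA ler_normD.
Qed.

Lemma abs_continuous_ext c d f g : (forall t, c <= t -> t <= d -> f t = g t) ->
  abs_continuous_on c d f -> abs_continuous_on c d g.
Proof.
move=> fg Hf e /Hf [r [r0 Hr]]; exists r; split => // n u v uv tr H.
rewrite (eq_bigr (fun i => `|f (v i) - f (u i)|)); first exact: Hr.
by move=> i _; have [cu uv' vd] := uv i; rewrite !fg //; lra.
Qed.

(** Record kept by the induction in [abs_continuous_ae_constant]: the intervals spent on exceptional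
    points, with gaps where the slope is small. As ordered lists, the records of adjacent intervals
    are simply concatenated. *)
Fixpoint chain (U : set R) x (s : seq (R * R)) y : Prop :=
  if s is p :: s' then
    [/\ x <= p.1, p.1 <= p.2, `]p.1, p.2[%classic `<=` U & chain U p.2 s' y]
  else x <= y.

Lemma chain_le U x s y : chain U x s y -> x <= y.
Proof. by elim: s x => //= p s IH x [? ? _ /IH]; lra. Qed.

Lemma chain_cat U x s y s' z : chain U x s y -> chain U y s' z -> chain U x (s ++ s') z.
Proof.
elim: s x => /= [x|p s IH x [? ? ?] /IH H /H //].
case: s' => /= [xy /(le_trans xy) //|p s' xy [? ? ? ?]]; split => //; exact: le_trans xy _.
Qed.

Lemma chain_mem U x s y p : chain U x s y -> p \in s ->
  [/\ x <= p.1, p.1 <= p.2, p.2 <= y & `]p.1, p.2[%classic `<=` U].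
Proof.
elim: s x => //= q s IH x [xq qq qU C]; rewrite in_cons => /predU1P[->|ps].
  by split => //; exact: chain_le C.
by have [? ? ? ?] := IH _ C ps; split => //; lra.
Qed.

Lemma chain_nth U x s y i j : chain U x s y -> (i < j)%N -> (j < size s)%N ->
  (nth (0, 0) s i).2 <= (nth (0, 0) s j).1.
Proof.
elim: s x i j => //= q s IH x [|i] [|j] //= [xq qq qU C] ij js.
  by have [] := chain_mem C (mem_nth (0, 0) js).
exact: (IH q.2 i j).
Qed.

Lemma chain_trivIset U x s y : chain U x s y ->
  trivIset [set: 'I_(size s)]
    (fun i => `](nth (0, 0) s i).1, (nth (0, 0) s i).2[%classic).
Proof.
move=> C i j _ _ [t [/=]]; rewrite !in_itv /= => /andP[i1 i2] /andP[j1 j2].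
apply/val_inj => /=; case: (ltngtP (val i) (val j)) => // H.
- by have K := chain_nth C H (ltn_ord j); exfalso; lra.
- by have K := chain_nth C H (ltn_ord i); exfalso; lra.
Qed.

(** The intervals are disjoint and lie in U, so a cover of small measure yields the small total
    length that absolute continuity asks for. *)
Lemma chain_length U x s y : open U -> chain U x s y ->
  ((\sum_(i < size s) ((nth (0, 0) s i).2 - (nth (0, 0) s i).1))%:E <= mu U)%E.
Proof.
move=> oU C.
pose F (i : 'I_(size s)) : set R := `](nth (0, 0) s i).1, (nth (0, 0) s i).2[%classic.
have -> : ((\sum_(i < size s) ((nth (0, 0) s i).2 - (nth (0, 0) s i).1))%:E =
   \sum_(i < size s) mu (F i))%E.
  rewrite -sumEFin; apply: eq_bigr => i _; rewrite lebesgue_measure_itv /= lte_fin.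
  have [_ pp _ _] := chain_mem C (mem_nth (0, 0) (ltn_ord i)).
  case: ltP => // pp'; congr (_%:E).
  by apply/eqP; rewrite subr_eq0 eq_le pp pp'.
rewrite -(@measure_bigsetU_ord _ _ _ mu _ xpredT F) //; last exact: chain_trivIset C.
- apply: le_measure; rewrite ?inE.
  + by apply: bigsetU_measurable => i _; exact: measurable_itv.
  + exact: measurable_realfun.open_measurable.
  + elim/big_rec: _ => // i A _ AU z [|/AU //].
    by have [_ _ _] := chain_mem C (mem_nth (0, 0) (ltn_ord i)); exact.
- by move=> i; exact: measurable_itv.
Qed.

Lemma abs_continuous_ae_constant c d f : c <= d -> abs_continuous_on c d f ->
  {ae mu, forall t, c < t -> is_derive t 1 f 0} -> f d = f c.
Proof.
(* The derivative is known only for t > c, whereas [cousin] uses every point of [c, d] as a tag; so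
   c joins the null set. *)
move=> cd Hf [N0 [mN0 N00 HN0]]; pose N := N0 `|` [set c].
have mN : measurable N by apply: measurableU.
have muN : mu N = 0%E.
  by rewrite measureU0 //; exact: lebesgue_measure_set1.
have HN t : c <= t -> ~ N t -> is_derive t 1 f 0.
  move=> ct nN; have : ~ N0 t by move=> ?; apply: nN; left.
  move/(contra_not (@HN0 t)) => /= /contrapT; apply.
  rewrite lt_neqAle ct andbT; apply/eqP => ct'; apply: nN; right; exact/esym.
suff : forall e : R, 0 < e -> `|f d - f c| <= e.
  move=> H; apply/eqP; rewrite -subr_eq0 -normr_le0; apply/ler_addgt0Pr => e e0.
  by rewrite add0r; exact: H.
move=> e e0; have k0 : 0 < e / 2 / (d - c + 1) by rewrite !divr_gt0 //; lra.
set k := e / 2 / (d - c + 1) in k0.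
have kE : k * (d - c) <= e / 2.
  rewrite /k mulrAC ler_pdivrMr; last by lra.
  by rewrite ler_pM2l //; lra.
have [r [r0 Hr]] := Hf (e / 2) ltac:(lra).
have [U [oU NU muU]] := lebesgue_regularity_outer mN (eq_ind_r (fun x => x < +oo)%E (ltry 0) muN) r0.
(* Outer regularity bounds the measure of U minus N; adding the null set back changes nothing. *)
have muUr : (mu U < r%:E)%E.
  have mU : measurable U by exact: measurable_realfun.open_measurable.
  suff -> : mu U = mu (U `\` N) by [].
  rewrite -{1}(setDUK NU) measureU //; first by rewrite [X in (X + _)%E]muN add0e.
  + exact: measurableD.
  + by rewrite setDIK.
(* Points outside N contribute slope at most k, points of N an interval inside
   U, whose total variation is small by absolute continuity. *)
have [s Cs Hs] : exists2 s, chain U c s d &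
    `|f d - f c| <= k * (d - c) + \sum_(p <- s) `|f p.2 - f p.1|.
  apply: (@cousin c d (fun x y => exists2 s, chain U x s y &
    `|f y - f x| <= k * (y - x) + \sum_(p <- s) `|f p.2 - f p.1|) cd).
  - move=> x y z _ _ _ _ [s1 C1 H1] [s2 C2 H2]; exists (s1 ++ s2); first exact: chain_cat C1 C2.
    rewrite big_cat /=.
    have -> : f z - f x = (f z - f y) + (f y - f x) by ring.
    by apply: le_trans (ler_normD _ _) _; lra.
  - move=> t ct td; have [Nt|nNt] := pselect (N t).
    + have /nbhs_ballP [h /= h0 Hh] := open_nbhs_nbhs (conj oU (NU _ Nt)).
      exists h => // u v cu ut tv vd tu vt; exists [:: (u, v)] => /=.
        split => //=; first exact: le_trans tv.
        move=> z; rewrite /= in_itv /= => /andP[uz zv]; apply: Hh.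
        by rewrite /ball /= ltr_norml; apply/andP; split; lra.
      by rewrite big_seq1 /= lerDr mulr_ge0 //; lra.
    + have /is_deriveP /(_ k k0) [h h0 Hh] := HN _ ct nNt.
      exists h => // u v cu ut tv vd tu vt; exists [::]; first by rewrite /=; lra.
      rewrite big_nil addr0.
      have ut' : `|u - t| = t - u by rewrite distrC ger0_norm // subr_ge0.
      have vt' : `|v - t| = v - t by rewrite ger0_norm // subr_ge0.
      have := Hh u; rewrite ut' mul0r subr0 => /(_ tu) Hu.
      have := Hh v; rewrite vt' mul0r subr0 => /(_ vt) Hv.
      have -> : f v - f u = (f v - f t) - (f u - f t) by ring.
      by apply: le_trans (ler_normB _ _) _; apply: le_trans (lerD Hv Hu) _; lra.
apply: le_trans Hs _.
have : \sum_(p <- s) `|f p.2 - f p.1| < e / 2.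
  rewrite (big_nth (0, 0)) big_mkord.
  apply: (Hr (size s) (fun i => (nth (0, 0) s i).1) (fun i => (nth (0, 0) s i).2)).
  - move=> i; have [? ? ? _] := chain_mem Cs (mem_nth (0, 0) (ltn_ord i)).
    by split.
  - exact: chain_trivIset Cs.
  - by rewrite -lte_fin; exact: le_lt_trans (chain_length oU Cs) muUr.
by lra.
Qed.

End AbsoluteContinuity.

(** The integrands of the Picard iteration: this class contains the continuous functions, is closed
    under sums and products, and its members are integrable on bounded intervals. *)
Definition locally_bounded_measurable (R : realType) (f : R -> R) : Prop :=
  measurable_fun setT f /\ forall T : R, exists M : R, forall t, `|t| <= T -> `|f t| <= M.

(* Vanishes for t <= 0, where the domain of integration is empty or a point. *)
Definition primitive (R : realType) (f : R -> R) (t : R) : R :=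
  (\int[lebesgue_measure]_(x in `[0%R, t]) f x)%R.

(** * Lebesgue primitives of locally bounded functions *)

Lemma expR_scale_continuous (R : realType) (k : R) : continuous (fun t : R => expR (k * t)).
Proof.
move=> t; apply: (@continuous_comp _ _ _ (fun y : R => k * y) expR).
  exact: mulrl_continuous.
exact: continuous_expR.
Qed.

Section Primitive.
Context {R : realType}.
Implicit Types (f g : R -> R) (s t c M : R).
Notation mu := (@lebesgue_measure R).
Notation lbm := (@locally_bounded_measurable R).
Notation I := (@primitive R).

Lemma lbm_cst c : lbm (fun=> c).
Proof. by split => [|T]; [exact: measurable_cst|exists `|c|]. Qed.

Lemma lbmD f g : lbm f -> lbm g -> lbm (fun t => f t + g t).
Proof.
move=> [mf bf] [mg bg]; split; first exact: measurable_realfun.measurable_funD.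
move=> T; have [M HM] := bf T; have [N HN] := bg T; exists (M + N) => t tT.
by apply: le_trans (ler_normD _ _) _; apply: lerD; [exact: HM|exact: HN].
Qed.

Lemma lbmM f g : lbm f -> lbm g -> lbm (fun t => f t * g t).
Proof.
move=> [mf bf] [mg bg]; split; first exact: measurable_realfun.measurable_funM.
move=> T; have [M HM] := bf T; have [N HN] := bg T; exists (M * N) => t tT.
by rewrite normrM ler_pM //; [exact: HM|exact: HN].
Qed.

Lemma lbmB f g : lbm f -> lbm g -> lbm (fun t => f t - g t).
Proof.
move=> lf lg.
have -> : (fun t => f t - g t) = (fun t => f t + -1 * g t) by apply/funext => t; rewrite mulN1r.
exact: lbmD (lbmM (lbm_cst (-1)) lg).
Qed.

Lemma lbm_continuous f : continuous f -> lbm f.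
Proof.
move=> cf; split; first exact: measurable_realfun.continuous_measurable_fun.
move=> T; have [T0|T0] := leP 0 T; last first.
  by exists 0 => t tT; have := normr_ge0 t; lra.
have [M _ HM] : exists2 M, 0 < M & forall t, - T <= t -> t <= T -> `|f t| <= M.
  apply: continuous_on_bounded; first by lra.
  move=> t _ _ e e0; have /cvgrPdist_lt /(_ e e0) /nbhs_ballP [d /= d0 Hd] := cf t.
  exists d => // y _ _ yt; rewrite distrC; apply: Hd.
  by rewrite /ball /= distrC.
by exists M => t; rewrite ler_norml => /andP[? ?]; exact: HM.
Qed.

Lemma lbm_integrable f (A : set R) : lbm f -> measurable A ->
  (exists T : R, forall t, A t -> `|t| <= T) -> mu.-integrable A (EFin \o f).
Proof.
move=> [mf bf] mA [T HT]; apply: measurable_bounded_integrable => //.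
- apply: (@le_lt_trans _ _ (mu `[- T, T]%classic)).
    apply: le_measure; rewrite ?inE //.
    by move=> t /HT; rewrite ler_norml /= in_itv.
  by rewrite lebesgue_measure_itv /=; case: ifP => // _; rewrite -EFinB ltry.
- exact: measurable_funTS.
- have [M HM] := bf T; exists M; split; first exact: num_real.
  by move=> x Mx y /HT /HM /le_trans; apply; exact: ltW.
Qed.

Lemma lbm_integrable_itv f (b1 b2 : bool) s t : lbm f ->
  mu.-integrable [set` Interval (BSide b1 s) (BSide b2 t)] (EFin \o f).
Proof.
move=> lf; apply: lbm_integrable => //; exists (`|s| + `|t|) => x /= xst.
have [sx xt] : s <= x /\ x <= t.
  by move: xst; rewrite in_itv; case: b1; case: b2 => /= /andP[]; split; lra.
rewrite ler_norml; apply/andP; split.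
- by have := ler_norm (- s); rewrite normrN; have := normr_ge0 t; lra.
- by have := ler_norm t; have := normr_ge0 s; lra.
Qed.

Lemma primitive0 f t : t <= 0 -> I f t = 0.
Proof.
rewrite /primitive le_eqVlt => /predU1P[->|t0]; first by rewrite set_itv1 Rintegral_set1.
by rewrite set_itv_ge ?Rintegral_set0 // bnd_simp -ltNge.
Qed.

Lemma primitive_max f t : I f t = I f (Num.max 0 t).
Proof. by have [//|t0] := leP 0 t; rewrite !primitive0 // ltW. Qed.

Lemma primitiveB f g t : lbm f -> lbm g -> I (fun x => f x - g x) t = I f t - I g t.
Proof. by move=> lf lg; apply: RintegralB => //; exact: lbm_integrable_itv. Qed.

Lemma primitiveZ f c t : lbm f -> I (fun x => c * f x) t = c * I f t.
Proof. by move=> lf; apply: RintegralZl => //; exact: lbm_integrable_itv. Qed.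

Lemma primitive_cst c t : 0 <= t -> I (fun=> c) t = c * t.
Proof.
move=> t0; rewrite /primitive Rintegral_cst // [X in fine X]lebesgue_measure_itv /= lte_fin.
case: ltP => [_|t0']; first by rewrite -EFinB subr0.
by have -> : t = 0 by apply/le_anti; rewrite t0 t0'.
Qed.

Lemma primitive_diff_le f M s t : lbm f -> 0 <= s -> s <= t ->
  (forall x, s < x -> x <= t -> `|f x| <= M) -> `|I f t - I f s| <= M * (t - s).
Proof.
move=> lf s0 st HM; rewrite /primitive Rintegral_itvB ?bnd_simp //; last exact: lbm_integrable_itv.
(* The sign of M can be read off only if some x lies in ]s, t]. *)
have M0 : 0 <= M \/ s = t.
  have [->|/eqP st'] := eqVneq s t; first by right.
  by left; apply: le_trans (HM t _ (lexx _)) => //; rewrite lt_neqAle st andbT; exact/eqP.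
apply: le_trans (le_normr_Rintegral _ _) _ => //; first exact: lbm_integrable_itv.
apply: (@le_trans _ _ (\int[mu]_(x in `]s, t]) M)%R).
  apply: le_Rintegral => //.
  - by apply: integrable_norm; exact: lbm_integrable_itv.
  - exact: (lbm_integrable_itv _ _ _ _ (lbm_cst M)).
  - by move=> x /=; rewrite in_itv /= => /andP[]; exact: HM.
rewrite Rintegral_cst // [X in fine X]lebesgue_measure_itv /= lte_fin.
by case: ltP => [_|ts] //=; rewrite mulr0; case: M0 => [M0|->]; rewrite ?subrr ?mulr0 ?mulr_ge0 ?subr_ge0.
Qed.

Lemma primitive_lipschitz f T M s t : lbm f -> (forall x, `|x| <= T -> `|f x| <= M) -> 0 <= M ->
  s <= t -> t <= T -> `|I f t - I f s| <= M * (t - s).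
Proof.
move=> lf HM M0 st tT; rewrite (primitive_max f t) (primitive_max f s).
have [t0|t0] := leP t 0.
  rewrite !primitive0 ?subrr ?normr0 ?mulr_ge0 ?subr_ge0 // ge_max lexx //; exact: le_trans t0.
apply: (@le_trans _ _ (M * (t - Num.max 0 s))); last first.
  by rewrite ler_wpM2l // lerD2l lerN2 le_max lexx orbT.
apply: primitive_diff_le => //; first by rewrite le_max lexx.
  by rewrite ge_max st ltW.
move=> x; rewrite gt_max => /andP[x0 _] xt; apply: HM.
by rewrite gtr0_norm //; lra.
Qed.

Lemma primitive_continuous f : lbm f -> continuous (I f).
Proof.
move=> lf t; apply/cvgrPdist_lt => e e0.
have [M HM] := lf.2 (`|t| + 1).
have M0 : 0 <= M by apply: le_trans (HM t _) => //; rewrite lerDl.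
have M1 : 0 < M + 1 by lra.
apply/nbhs_ballP; exists (Num.min 1 (e / (M + 1))); first by rewrite /= lt_min ltr01 divr_gt0.
move=> y; rewrite /ball /= lt_min ltr_pdivlMr // => /andP[ty1 tye].
have tT : t <= `|t| + 1 by have := ler_norm t; lra.
have yT : y <= `|t| + 1.
  by move: ty1; rewrite ltr_norml => /andP[? ?]; have := ler_norm t; lra.
have key : `|I f t - I f y| <= M * `|t - y|.
  have [ty|yt] := leP y t.
    by rewrite (ger0_norm (_ : 0 <= t - y)) ?subr_ge0 //; exact: primitive_lipschitz HM M0 ty tT.
  rewrite distrC (distrC t) (gtr0_norm (_ : 0 < y - t)) ?subr_gt0 //.
  exact: primitive_lipschitz HM M0 (ltW yt) yT.
apply: le_lt_trans key _; apply: le_lt_trans tye.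
by have := normr_ge0 (t - y); nra.
Qed.

Lemma primitive_halfline_derivative f t : lbm f -> 0 <= t ->
  (forall e, 0 < e -> exists2 d : R, 0 < d &
     forall y, 0 <= y -> `|y - t| < d -> `|f y - f t| < e) ->
  halfline_derivative 0 (I f) t (f t).
Proof.
move=> lf t0 cf e e0; have [d d0 Hd] := cf e e0; exists d => // y y0 yd.
have key s u : 0 <= s -> s <= u -> `|s - t| < d -> `|u - t| < d ->
    `|I f u - I f s - f t * (u - s)| <= e * (u - s).
  move=> s0 su; rewrite !ltr_norml => /andP[s1 s2] /andP[u1 u2].
  have lc := lbm_cst (f t).
  have := @primitive_diff_le (fun x => f x - f t) e s u (lbmB lf lc) s0 su.
  rewrite !primitiveB // !primitive_cst //; last exact: le_trans su.
  have -> : I f u - f t * u - (I f s - f t * s) = I f u - I f s - f t * (u - s) by ring.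
  apply => x sx xu; apply/ltW/Hd; first by lra.
  by rewrite ltr_norml; apply/andP; split; lra.
have tt : `|t - t| < d by rewrite subrr normr0.
have [ty|yt] := leP t y.
  by rewrite (ger0_norm (_ : 0 <= y - t)) ?subr_ge0 //; exact: key.
have := key y t y0 (ltW yt) yd tt.
rewrite (ltr0_norm (_ : y - t < 0)) ?subr_lt0 // opprB -normrN.
by congr (`| _ | <= _); ring.
Qed.

Lemma lbm_locally_integrable f : lbm f -> locally_integrable setT f.
Proof.
move=> lf; split; [exact: lf.1|exact: openT|move=> K _ cK].
have mK : measurable K by apply: measurable_realfun.closed_measurable; exact: compact_closed.
suff /integrableP [] : mu.-integrable K (EFin \o f) by [].
apply: lbm_integrable => //; have [T [_ HT]] := compact_bounded cK.
by exists (T + 1) => t Kt; apply: HT => //; lra.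
Qed.

Lemma primitive_ae_derive f : lbm f ->
  {ae mu, forall t, 0 < t -> is_derive t 1 (I f) (f t)}.
Proof.
move=> lf; have [N [mN N0 HN]] := lebesgue_differentiation (lbm_locally_integrable lf).
suff key (t : R) : lebesgue_pt f t -> 0 < t -> is_derive t 1 (I f) (f t).
  by exists N; split => // t /= H; apply: HN => /= Lt; apply: H; exact: key.
(* Any right end beyond t would do, as differentiability at the Lebesgue point t is local. *)
move=> Lt t0; have tt1 : t < t + 1 by rewrite ltrDl.
have [||D E] := @FTC1_lebesgue_pt R f (BLeft 0) t (t + 1) tt1 _ _ Lt.
- exact: lbm_integrable_itv.
- by rewrite (@lte_fin R).
- by split; [exact: D|rewrite derive1E in E; exact: E].
Qed.

(** Integration against the weight exp(L x) gains the factor 1 / L, the source of the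
    contraction. *)
Lemma primitive_expR_le f K L t : lbm f -> 0 < L -> 0 <= t ->
  (forall x, 0 <= x -> x <= t -> `|f x| <= K * expR (L * x)) ->
  `|I f t| <= K / L * expR (L * t).
Proof.
move=> lf L0 t0 Hf.
have cE : continuous (fun x : R => expR (L * x)) by exact: expR_scale_continuous.
have lE := lbm_continuous cE.
(* The integral of the exponential is found by showing that [h] has derivative zero, hence is
   Lipschitz with constant 0. *)
have E : L * I (fun x => expR (L * x)) t - expR (L * t) = -1.
  pose h x := L * I (fun x => expR (L * x)) x + -1 * expR (L * x).
  have h0 : h 0 = -1 by rewrite /h primitive0 // mulr0 expR0 add0r mulr1.
  have : `|h t - h 0| <= 0 * (t - 0).
    apply: (@halfline_derivative_lipschitz R 0 t h (fun x => L * expR (L * x) + -1 * (L * expR (L * x)))) => //.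
    move=> x x0 xt; split; last by rewrite mulN1r subrr normr0.
    apply: halfline_derivativeD; apply: halfline_derivativeZ.
      apply: primitive_halfline_derivative => // e e0.
      have /cvgrPdist_lt /(_ e e0) /nbhs_ballP [d /= d0 Hd] := cE x.
      by exists d => // y _ yx; rewrite distrC; apply: Hd; rewrite /ball /= distrC.
    have /is_deriveP H : is_derive x 1 (fun x : R => expR (L * x)) (L * expR (L * x)).
      have dL : is_derive x 1 (fun y : R => L * y) L.
        apply/is_deriveP => e e0; exists 1 => // y _.
        have -> : L * y - L * x - L * (y - x) = 0 by ring.
        by rewrite normr0 mulr_ge0 // ltW.
      rewrite mulrC; exact: (is_derive1_comp (is_derive_expR _) dL).
    by move=> e /H [d d0 Hd]; exists d => // y _; exact: Hd.
  rewrite mul0r normr_le0 subr_eq0 h0 => /eqP; rewrite /h => <-; ring.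
have K0 : 0 <= K.
  have := Hf 0 (lexx _) t0; rewrite mulr0 expR0 mulr1; exact: le_trans.
apply: (@le_trans _ _ (K * I (fun x => expR (L * x)) t)).
  rewrite -primitiveZ //; apply: le_trans (le_normr_Rintegral _ _) _ => //.
    exact: lbm_integrable_itv.
  apply: le_Rintegral => //.
  - by apply: integrable_norm; exact: lbm_integrable_itv.
  - exact: (lbm_integrable_itv _ _ _ _ (lbmM (lbm_cst K) lE)).
  - by move=> x /=; rewrite in_itv /= => /andP[]; exact: Hf.
rewrite -mulrA ler_wpM2l // mulrC ler_pdivlMr // mulrC.
lra.
Qed.

End Primitive.

(** * Picard iteration *)

Section Picard.
Context {R : realType}.
Implicit Types (f g v w : R -> R) (s t c : R).
Notation lbm := (@locally_bounded_measurable R).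
Notation I := (@primitive R).

Variables (alpha beta : R -> R) (M p q : R).
Hypotheses (lalpha : lbm alpha) (lbeta : lbm beta) (M0 : 0 <= M).
Hypothesis (alphaM : forall t, 0 <= t -> `|alpha t| <= M).
Hypothesis (betaM : forall t, 0 <= t -> `|beta t| <= M).

(* In the norm sup |v t| exp(- L |t|) the Picard map is a 1/2-contraction. *)
Let L := 4 * M + 1.
Let L1 : 1 <= L. Proof. by have := M0; rewrite /L; lra. Qed.
Let L0 : 0 < L. Proof. by have := M0; rewrite /L; lra. Qed.

(* The fixed point is v = x', where x = p + I v. *)
Definition picard v t := q - I (fun s => alpha s * v s + beta s * (p + I v s)) t.

Lemma lbm_picard_integrand v : lbm v -> lbm (fun s => alpha s * v s + beta s * (p + I v s)).
Proof.
move=> lv; apply: lbmD; apply: lbmM => //; apply: lbmD; first exact: lbm_cst.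
exact: lbm_continuous (primitive_continuous lv).
Qed.

Lemma picard_continuous v : lbm v -> continuous (picard v).
Proof.
move=> lv t; apply: continuousB; first exact: cst_continuous.
exact: primitive_continuous (lbm_picard_integrand lv) t.
Qed.

Lemma lbm_picard v : lbm v -> lbm (picard v).
Proof. by move=> lv; apply: lbm_continuous; exact: picard_continuous. Qed.

(** The iterates are total functions, so the weight uses |t|; for negative t the primitive is
    zero. *)
Lemma primitive_weight_le f K t : lbm f ->
  (forall x, 0 <= x -> `|f x| <= K * expR (L * `|x|)) ->
  `|I f t| <= K / L * expR (L * `|t|).
Proof.
move=> lf Hf; have K0 : 0 <= K.
  by have := Hf 0 (lexx _); rewrite normr0 mulr0 expR0 mulr1; exact: le_trans.
have [t0|t0] := leP 0 t.
  rewrite (ger0_norm t0); apply: primitive_expR_le; [exact: lf|exact: L0|exact: t0|move=> x x0 _].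
  by have := Hf x x0; rewrite (ger0_norm x0).
rewrite primitive0 ?(ltW t0) // normr0; apply: mulr_ge0; last exact: expR_ge0.
by apply: divr_ge0 => //; exact: ltW L0.
Qed.

Lemma picard_contraction v w K : lbm v -> lbm w ->
  (forall t, `|v t - w t| <= K * expR (L * `|t|)) ->
  forall t, `|picard v t - picard w t| <= K / 2 * expR (L * `|t|).
Proof.
move=> lv lw H t; have K0 : 0 <= K.
  by have := H 0; rewrite normr0 mulr0 expR0 mulr1; exact: le_trans.
pose F s := alpha s * (v s - w s) + beta s * I (fun x => v x - w x) s.
have lvw := lbmB lv lw.
have IF : I F t = I (fun s => alpha s * v s + beta s * (p + I v s)) t -
    I (fun s => alpha s * w s + beta s * (p + I w s)) t.
  rewrite -primitiveB; [|exact: lbm_picard_integrand|exact: lbm_picard_integrand].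
  congr (I _ t); apply/funext => s; rewrite /F primitiveB //; ring.
have -> : picard v t - picard w t = - I F t.
  rewrite IF /picard.
  move: (I (fun s => alpha s * v s + _) t) (I (fun s => alpha s * w s + _) t) => x y.
  ring.
rewrite normrN.
have lF : lbm F.
  by apply: lbmD; apply: lbmM => //; exact: lbm_continuous (primitive_continuous lvw).
(* Each of the two terms of [F] is at most M K times the weight: the inner primitive loses nothing
   because L >= 1. Then 2 M / L <= 1 / 2 by the choice of [L]. *)
apply: (@le_trans _ _ ((2 * M * K) / L * expR (L * `|t|))); last first.
  rewrite ler_wpM2r ?expR_ge0 // ler_pdivrMr //; have := M0; rewrite /L; nra.
apply: primitive_weight_le => // x x0.
have E0 := expR_ge0 (L * `|x|).
have J : `|I (fun x => v x - w x) x| <= K * expR (L * `|x|).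
  apply: le_trans (primitive_weight_le x lvw (fun y _ => H y)) _.
  by rewrite ler_wpM2r // ler_pdivrMr // ler_peMr.
apply: le_trans (ler_normD _ _) _; rewrite !normrM.
have -> : 2 * M * K * expR (L * `|x|) = M * (K * expR (L * `|x|)) + M * (K * expR (L * `|x|)) by ring.
by apply: lerD; apply: ler_pM => //; [exact: alphaM|exact: betaM].
Qed.

Let u n := iter n picard (fun=> 0).

Let lbm_u n : lbm (u n).
Proof. by elim: n => [|n IH]; [exact: lbm_cst|exact: lbm_picard]. Qed.

(** Size of the first iterate, q minus the integral of beta p, which starts the geometric series. *)
Let C := `|q| + M * `|p|.

Let C0 : 0 <= C. Proof. by rewrite addr_ge0 // mulr_ge0. Qed.

Let u_step n t : `|u n.+1 t - u n t| <= C / 2 ^+ n * expR (L * `|t|).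
Proof.
elim: n t => [|n IH] t; last first.
  have := picard_contraction (lbm_u n.+1) (lbm_u n) IH t.
  by rewrite exprSr invfM mulrA.
rewrite expr0 invr1 mulr1 subr0 /u /= /picard.
have lz : lbm (fun=> 0 : R) by exact: lbm_cst.
apply: le_trans (ler_normB _ _) _; rewrite /C mulrDl; apply: lerD.
  by apply: ler_peMr => //; apply: le_trans (expR_ge1Dx _); rewrite lerDl mulr_ge0 // ltW.
apply: (@le_trans _ _ (M * `|p| / L * expR (L * `|t|))); last first.
  by rewrite ler_wpM2r ?expR_ge0 // ler_pdivrMr // ler_peMr // mulr_ge0.
apply: primitive_weight_le; first exact: lbm_picard_integrand lz.
move=> x x0; rewrite mulr0 add0r.
have -> : I (fun=> 0) x = 0 by rewrite primitive_cst // mul0r.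
rewrite addr0 normrM; apply: (@le_trans _ _ (M * `|p|)).
  by rewrite ler_wpM2r //; exact: betaM.
apply: ler_peMr; first exact: mulr_ge0.
by apply: le_trans (expR_ge1Dx _); rewrite lerDl mulr_ge0 // ltW.
Qed.

(** The factor 1 - 2^-k comes from the partial geometric sum; with the plain bound 2 C / 2^n the
    induction on k would not close. *)
Let u_dist n k t : `|u (k + n)%N t - u n t| <= 2 * C / 2 ^+ n * (1 - 2^-1 ^+ k) * expR (L * `|t|).
Proof.
elim: k => [|k IH]; first by rewrite add0n subrr normr0 expr0 subrr mulr0 mul0r.
have -> : u (k.+1 + n)%N t - u n t = (u (k + n).+1 t - u (k + n)%N t) + (u (k + n)%N t - u n t).
  by rewrite addrA subrK addSn.
apply: le_trans (ler_normD _ _) _; apply: le_trans (lerD (u_step _ _) IH) _.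
rewrite -mulrDl ler_wpM2r ?expR_ge0 // exprD exprS exprVn.
have n0 : (2 : R) ^+ n != 0 by rewrite expf_neq0 // pnatr_eq0.
have k0 : (2 : R) ^+ k != 0 by rewrite expf_neq0 // pnatr_eq0.
by rewrite le_eqVlt; apply/orP; left; apply/eqP; field; rewrite n0 k0.
Qed.

Let u_le n m t : (n <= m)%N -> `|u m t - u n t| <= 2 * C / 2 ^+ n * expR (L * `|t|).
Proof.
move=> nm; have := u_dist n (m - n) t; rewrite subnK // => /le_trans; apply.
rewrite ler_wpM2r ?expR_ge0 //; apply: ler_piMr.
  by rewrite divr_ge0 ?exprn_ge0 // mulr_ge0.
by rewrite gerBl exprn_ge0 // invr_ge0.
Qed.

Let pow2_small (K e : R) : 0 <= K -> 0 < e -> exists n, K / 2 ^+ n < e.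
Proof.
move=> K0 e0; exists (Num.bound (K / e)).
rewrite ltr_pdivrMr ?exprn_gt0 // mulrC -ltr_pdivrMr //.
have := archi_boundP (divr_ge0 K0 (ltW e0)) => /lt_trans; apply.
by rewrite -natrX ltr_nat ltn_expl.
Qed.

Let u_cvg t : cvg (u n t @[n --> \oo]).
Proof.
apply/cauchy_cvgP/cauchy_exP => e e0.
have [n Hn] := @pow2_small (2 * C * expR (L * `|t|) * 2) e ltac:(by rewrite !mulr_ge0 ?expR_ge0) e0.
have H m : (n <= m)%N -> `|u m t - u n t| < e / 2.
  move=> /u_le /le_lt_trans; apply; rewrite ltr_pdivlMr //; move: Hn.
  have -> // : 2 * C * expR (L * `|t|) * 2 / 2 ^+ n = 2 * C / 2 ^+ n * expR (L * `|t|) * 2.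
  by field; rewrite expf_neq0 // pnatr_eq0.
exists (u n t); exists n => // m /= /H; rewrite /ball /= distrC => h; lra.
Qed.

Let ulim t := lim (u n t @[n --> \oo]).

Let ulim_le n t : `|ulim t - u n t| <= 2 * C / 2 ^+ n * expR (L * `|t|).
Proof.
have cu : u m t - u n t @[m --> \oo] --> ulim t - u n t.
  by apply: cvgB; [exact: u_cvg|exact: cvg_cst].
have cn : `|u m t - u n t| @[m --> \oo] --> `|ulim t - u n t| by exact: cvg_norm.
rewrite -(cvg_lim _ cn) //; apply: limr_le.
  by apply/cvg_ex; exists `|ulim t - u n t|.
by exists n => // m /= nm; exact: u_le.
Qed.

Let lbm_ulim : lbm ulim.
Proof.
split.
  by apply: (measurable_realfun.measurable_fun_cvg (h := u)) => [m|x _]; [exact: (lbm_u m).1|exact: u_cvg].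
(* The estimate at n = 0, where the iterate is zero, bounds the limit itself. *)
move=> T; exists (2 * C * expR (L * T)) => t tT.
have := ulim_le 0 t; rewrite subr0 expr0 divr1 => /le_trans; apply.
by rewrite ler_wpM2l ?mulr_ge0 ?C0 // ler_expR ler_pM2l ?L0.
Qed.

Lemma phase_solution : exists v, continuous v /\
  forall t, v t = q - I (fun s => alpha s * v s + beta s * (p + I v s)) t.
Proof.
have fixed t : ulim t = picard ulim t.
  apply/eqP; rewrite -subr_eq0 -normr_le0; apply/ler_addgt0Pr => e e0; rewrite add0r.
  (* Both differences below are at most C / 2^n times the weight, so 4 C leaves room to spare. *)
  have [n Hn] := @pow2_small (4 * C * expR (L * `|t|)) e ltac:(by rewrite !mulr_ge0 ?expR_ge0) e0.
  have -> : ulim t - picard ulim t = (ulim t - u n.+1 t) - (picard ulim t - picard (u n) t).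
    by rewrite -[u n.+1 t]/(picard (u n) t); move: (ulim t) (picard ulim t) (picard (u n) t) => x y z; ring.
  apply: le_trans (ler_normB _ _) _.
  apply: le_trans (lerD (ulim_le _ _) (picard_contraction lbm_ulim (lbm_u n) (ulim_le n) t)) _.
  have H0 : 0 <= C / 2 ^+ n * expR (L * `|t|).
    by rewrite !mulr_ge0 ?expR_ge0 // invr_ge0 exprn_ge0.
  have n0 : (2 : R) ^+ n != 0 by rewrite expf_neq0 // pnatr_eq0.
  have E1 : 2 * C / 2 ^+ n.+1 * expR (L * `|t|) = C / 2 ^+ n * expR (L * `|t|).
    by rewrite exprS; field.
  have E2 : 2 * C / 2 ^+ n / 2 * expR (L * `|t|) = C / 2 ^+ n * expR (L * `|t|).
    by field.
  have E3 : 4 * C * expR (L * `|t|) / 2 ^+ n = 4 * (C / 2 ^+ n * expR (L * `|t|)) by field.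
  by rewrite E1 E2; rewrite E3 in Hn; lra.
exists ulim; split; last exact: fixed.
(* As a pointwise limit [ulim] is only known to be measurable and locally bounded; it is continuous
   as a value of [picard]. *)
have -> : ulim = picard ulim by exact/funext.
exact: picard_continuous lbm_ulim.
Qed.

End Picard.

(** * Null sets and periodic functions *)

Section HalflineCoefficients.
Context {R : realType}.
Notation mu := (@lebesgue_measure R).

Lemma measurable_shift (c : R) :
  measurable_fun setT ((fun t => t + c) : R -> measurableTypeR R).
Proof.
apply: measurable_realfun.continuous_measurable_fun => t.
exact: continuousD (@cvg_id _ _) (@cst_continuous _ _ _ _).
Qed.

Lemma lebesgue_measure_shift (c : R) (A : set R) : measurable A ->
  mu [set t | A (t + c)] = mu A.
Proof.
move=> mA.
have mf := measurable_shift c.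
apply/esym; rewrite -[RHS]/(pushforward mu ((fun t => t + c) : R -> measurableTypeR R) A).
apply: lebesgue_measure_unique => //= _ [[x y]] _ <-.
rewrite /pushforward.
have -> : (fun t : R => t + c) @^-1` `]x, y] = `]x - c, y - c]%classic.
  by apply/seteqP; split => t /=; rewrite !in_itv /= ltrBlDr lerBrDr.
by rewrite !lebesgue_measure_itv /= !lte_fin ltrD2r -!EFinB opprB addrA subrK.
Qed.

Lemma ae_shift (c : R) (P : R -> Prop) : {ae mu, forall t, P t} -> {ae mu, forall t, P (t + c)}.
Proof.
move=> [N [mN N0 HN]]; exists [set t | N (t + c)]; split.
- by rewrite -[X in measurable X]setTI; exact: measurable_shift.
- by rewrite -N0; exact: lebesgue_measure_shift.
- by move=> t /= nP; apply: HN.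
Qed.

(** For each rational r the set where b < r is a Borel set up to a negligible one. Countably many
    negligible sets, together with the set where the bound fails, fit into one Borel null set [Z];
    off [Z] the function is Borel, and on [Z] it is replaced by 0. *)
Lemma lebesgue_measurable_borel_version (b : R -> R) :
  lebesgue_measurable_fun `[0, +oo[ b -> ess_bounded b ->
  exists (beta : R -> R) (M : R),
    [/\ measurable_fun setT beta, forall t, `|beta t| <= M &
        {ae mu, forall t, 0 <= t -> beta t = b t}].
Proof.
move=> mb [M HM].
pose E : set R := `[0, +oo[%classic.
(* An enumeration of the rationals; a number that codes no rational gives 0, a harmless
   repetition. *)
pose r n : R := ratr (odflt 0 (unpickle n : option rat)).
have HBN n : exists BN : set R * set R, [/\ measurable BN.1, mu.-negligible BN.2 &
    E `&` [set t | b t < r n] = BN.1 `|` BN.2].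
  have mE : (((wlength idfun)^*)%mu.-cara).-measurable (E : set (caratheodory_type ((@wlength R idfun)^*)%mu)).
    by apply: sub_caratheodory; exact: measurable_itv.
  have mray : measurable `]-oo, (r n)[%classic by exact: measurable_itv.
  have EQ : E `&` [set t | b t < r n] = E `&` b @^-1` `]-oo, (r n)[.
    by apply/seteqP; split => t [Et /= bt]; split => //=; move: bt; rewrite in_itv.
  have := mb mE _ mray; rewrite -completed_caratheodory_measurable g_sigma_completed_algebra_genE.
  move=> [B mB [N nN BN]]; exists (B, N); split => //=; rewrite EQ; exact: esym BN.
have /choice [BN HBN'] := HBN.
have nZ : mu.-negligible ((\bigcup_n (BN n).2) `|` ~` [set t | 0 <= t -> `|b t| <= M]).
  apply: negligibleU; last exact: HM.
  by apply: negligible_bigcup => n; have [] := HBN' n.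
have [Z [mZ Z0 HZ]] := nZ.
have mE : measurable E by exact: measurable_itv.
have mD : measurable (E `\` Z) by exact: measurableD.
(* The new function takes the value 0, and M has not been shown nonnegative; hence the absolute
   value. *)
exists (b \_ (E `\` Z)), `|M|; split.
- apply/measurable_restrict => //.
  apply: (measurability _ (measurable_realfun.RGenInftyO.measurableE R)).
  move=> _ [_ [x ->] <-]; rewrite setTI.
  have -> : (E `\` Z) `&` b @^-1` `]-oo, x[ =
    \bigcup_(n in [set n | r n < x]) ((BN n).1 `\` Z).
    apply/seteqP; split.
    + move=> t [[Et nZt]] /=; rewrite in_itv /= => btx.
      have [q] := rat_in_itvoo btx; rewrite in_itv /= => /andP[bq qx].
      have rq : r (pickle q) = ratr q by rewrite /r pickleK.
      exists (pickle q); rewrite /= ?rq //; split => //.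
      have [_ _ HE] := HBN' (pickle q).
      have : (E `&` [set t | b t < r (pickle q)]) t by split => //=; rewrite rq.
      rewrite HE => -[//|Nt]; exfalso; apply: nZt; apply: HZ; left; by exists (pickle q).
    + move=> t [n /= rx [Bt nZt]]; have [_ _ HE] := HBN' n.
      have : (E `&` [set t | b t < r n]) t by rewrite HE; left.
      by move=> [Et /= bt]; split => //=; rewrite in_itv /=; exact: lt_trans rx.
  by apply: bigcup_measurable => n _; apply: measurableD => //; have [] := HBN' n.
- move=> t; rewrite /patch; case: ifPn => [|_]; last by rewrite normr0.
  rewrite inE => -[Et nZt]; apply: le_trans (ler_norm _); apply: contrapT => H.
  apply: nZt; apply: HZ; right => /= H'; apply: H; apply: H'.
  by move: Et; rewrite /E /= in_itv /= andbT.
- exists Z; split => // t /= H; apply: contrapT => nZt; apply: H => t0.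
  by rewrite /patch ifT // inE; split => //; rewrite /E /= in_itv /= andbT.
Qed.

Lemma continuous_on_halfline (s : R) (f : R -> R) :
  (forall t, s <= t -> forall e, 0 < e -> exists2 d : R, 0 < d &
     forall y, s <= y -> `|y - t| < d -> `|f y - f t| < e) ->
  forall d, continuous_on s d f.
Proof.
by move=> cf d t st td e e0; have [r r0 Hr] := cf t st e e0; exists r => // y sy _; exact: Hr.
Qed.

Lemma periodic_halfline_nat (omega : R) (f : R -> R) n t : 0 <= omega ->
  periodic_halfline omega f -> 0 <= t -> f (t + n%:R * omega) = f t.
Proof.
move=> w0 pf t0; elim: n => [|n IH]; first by rewrite mul0r addr0.
rewrite -natr1 mulrDl mul1r addrA pf // addr_ge0 // mulr_ge0 //.
Qed.

Lemma periodic_halfline_reduce (omega : R) (f : R -> R) t : 0 < omega -> 0 <= t ->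
  periodic_halfline omega f -> exists2 s, 0 <= s <= omega & f t = f s.
Proof.
move=> w0 t0 pf; have q0 : 0 <= t / omega by rewrite divr_ge0 // ltW.
have /andP[nt tn] := truncn_itv q0; set n := Num.truncn (t / omega) in nt tn.
rewrite ler_pdivlMr // in nt; rewrite ltr_pdivrMr // -natr1 mulrDl mul1r in tn.
exists (t - n%:R * omega); first by apply/andP; split; lra.
by rewrite -[in LHS](subrK (n%:R * omega) t) (periodic_halfline_nat n (ltW w0) pf) // subr_ge0.
Qed.

Lemma periodic_continuous_bounded (omega : R) (f : R -> R) : 0 < omega ->
  periodic_halfline omega f -> continuous_on 0 omega f -> bounded_halfline f.
Proof.
move=> w0 pf /(continuous_on_bounded (ltW w0)) [M M0 HM].
exists M => t t0; have [s /andP[s0 sw] ->] := periodic_halfline_reduce w0 t0 pf.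
exact: HM.
Qed.

(** Clamping at 0 is 1-Lipschitz, so one-sided continuity at 0 becomes two-sided. *)
Lemma continuous_extend_left (f : R -> R) : (forall d, 0 <= d -> continuous_on 0 d f) ->
  continuous (fun t : R => f (Num.max 0 t)).
Proof.
move=> cf t; apply/cvgrPdist_lt => e e0.
have m0 : 0 <= Num.max 0 t by rewrite le_max lexx.
(* One unit of room on the right; the radius is capped by 1 below, so that nearby points stay in the
   interval. *)
have d0 : 0 <= Num.max 0 t + 1 by lra.
have [|r r0 Hr] := cf _ d0 (Num.max 0 t) m0 _ e e0; first by lra.
have mm y : `|Num.max 0 y - Num.max 0 t| <= `|y - t|.
  case: (leP 0 y) => ?; case: (leP 0 t) => ? //; rewrite ?subrr ?normr0 // ?sub0r ?subr0 ?normrN.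
  - by rewrite !ger0_norm //; lra.
  - by rewrite distrC !ger0_norm //; lra.
apply/nbhs_ballP; exists (Num.min 1 r); first by rewrite /= lt_min ltr01.
move=> y; rewrite /ball /= lt_min distrC => /andP[y1 yr]; rewrite distrC; apply: Hr.
- by rewrite le_max lexx.
- by have := mm y; move=> /le_lt_trans /(_ y1); rewrite ltr_norml => /andP[_]; lra.
- exact: le_lt_trans (mm y) yr.
Qed.

End HalflineCoefficients.

(** The first-order system behind the equation. With v as separate data, sums, shifts and
    restrictions are taken without computing a limit. *)
Definition phase_pair (R : realType) (a b : R -> R) (s : R) (x v : R -> R) : Prop :=
  [/\ forall t, s <= t -> halfline_derivative s x t (v t), loc_abs_continuous s v &
      {ae (@lebesgue_measure R), forall t, s < t ->
         is_derive t 1 v (- (a t * v t) - b t * x t)}].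

(** * Solutions and their derivatives *)

Section PhasePairs.
Context {R : realType}.
Variables (a b : R -> R).
Implicit Types (s t c d : R) (x y z v w : R -> R).
Notation mu := (@lebesgue_measure R).
Notation I := (@primitive R).
Notation phase := (@phase_pair R a b).

Lemma ae_imply2 (P Q S : R -> Prop) : {ae mu, forall t, P t} -> {ae mu, forall t, Q t} ->
  (forall t, P t -> Q t -> S t) -> {ae mu, forall t, S t}.
Proof. by move=> HP HQ PQS; exact: (@filterS2 _ _ (ae_filter_ringOfSetsType mu) _ _ _ PQS HP HQ). Qed.

Lemma solution_phase_pair s x : is_solution a b s x -> phase s x (deriv_halfline s x).
Proof.
move=> [dx acx [N [mN N0 HN]]]; split => //.
  by move=> t st; apply: derivable_halflineP; exact: dx.
exists N; split => // t /= H; apply: HN => /= H'; apply: H => /H' [D E].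
split => //; apply/eqP; rewrite -subr_eq0 -E; apply/eqP; ring.
Qed.

Lemma phase_pair_deriv s x v t : phase s x v -> s <= t -> deriv_halfline s x t = v t.
Proof. by move=> [dx _ _] st; apply: halfline_derivative_deriv => //; exact: dx. Qed.

Lemma phase_pair_solution s x v : phase s x v -> is_solution a b s x.
Proof.
move=> H; have Hd := phase_pair_deriv H; have [dx acv [N [mN N0 HN]]] := H; split.
- by move=> t /dx /halfline_derivative_derivable.
- move=> c d sc cd; apply: (abs_continuous_ext _ (acv c d sc cd)) => t ct td.
  by rewrite Hd // (le_trans sc).
- exists N; split => // t /= K; apply: HN => /= K'; apply: K => st.
  have : is_derive t 1 (deriv_halfline s x) (- (a t * v t) - b t * x t).
    (* [deriv_halfline] agrees with v only on [s, +oo[, which contains the ball of radius t - s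
       around t. *)
    apply: (near_eq_is_derive _ (K' st)); apply/nbhs_ballP.
    exists (t - s); first by rewrite /= subr_gt0.
    by move=> y; rewrite /ball /= ltr_norml => /andP[_ ys]; rewrite Hd //; lra.
  move=> [D E]; split => //; rewrite E Hd ?ltW //; ring.
Qed.

Lemma phase_pairS s s' x v : s <= s' -> phase s x v -> phase s' x v.
Proof.
move=> ss [dx acv [N [mN N0 HN]]]; split.
- move=> t st; apply: (halfline_derivativeS ss); apply: dx; exact: (le_trans ss st).
- by move=> c d sc cd; apply: acv => //; exact: (le_trans ss sc).
- exists N; split => // t /= K; apply: HN => /= K'; apply: K => st; apply: K'.
  exact: le_lt_trans ss st.
Qed.

Lemma abs_continuous_linear e f c d v w : abs_continuous_on c d v -> abs_continuous_on c d w ->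
  c <= d -> abs_continuous_on c d (fun t => e * v t + f * w t).
Proof.
move=> Hv Hw cd; have cst k : abs_continuous_on c d (fun=> k : R).
  by apply: (@lipschitz_abs_continuous _ _ _ _ 0) => *; rewrite subrr normr0 mul0r.
by apply: abs_continuousD; apply: abs_continuousM.
Qed.

Lemma is_derive_linear e f v w t dv dw : is_derive t 1 v dv -> is_derive t 1 w dw ->
  is_derive t 1 (fun u => e * v u + f * w u) (e * dv + f * dw).
Proof.
move=> Hv Hw; have := is_deriveD (is_deriveZ e Hv) (is_deriveZ f Hw).
by rewrite /GRing.scale /=.
Qed.

Lemma phase_pair_linear s c d x v y w : phase s x v -> phase s y w ->
  phase s (fun t => c * x t + d * y t) (fun t => c * v t + d * w t).
Proof.
move=> [dx acv aex] [dy acw aey]; split.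
- move=> t st; apply: halfline_derivativeD; apply: halfline_derivativeZ; auto.
- by move=> k l sk kl; apply: abs_continuous_linear => //; [exact: acv|exact: acw].
- apply: (ae_imply2 aex aey) => t Hx Hy st.
  have := is_derive_linear c d (Hx st) (Hy st); congr is_derive; ring.
Qed.

(** This makes the monodromy operator well defined; the exceptional null set is translated along
    with the solution. *)
Lemma phase_pair_shift omega x v : 0 <= omega ->
  periodic_halfline omega a -> periodic_halfline omega b -> phase 0 x v ->
  phase 0 (fun t => x (t + omega)) (fun t => v (t + omega)).
Proof.
move=> w0 pa pb [dx acv aex]; split.
- move=> t t0; apply: halfline_derivative_comp_shift => //; apply: dx; exact: addr_ge0.
- move=> c d c0 cd e e0; have [|r [r0 Hr]] := acv (c + omega) (d + omega) (addr_ge0 c0 w0) _ e e0.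
    by rewrite lerD2r.
  exists r; split => // n f g fg tr sm.
  apply: (Hr n (fun i => f i + omega) (fun i => g i + omega)).
  + by move=> i; have [? ? ?] := fg i; rewrite !lerD2r.
  + move=> i j _ _ [t [/=]]; rewrite !in_itv /= => /andP[i1 i2] /andP[j1 j2].
    by apply: tr => //; exists (t - omega); split; rewrite /= in_itv /=; apply/andP; split; lra.
  + by under eq_bigr do rewrite opprD addrACA subrr addr0.
- have aeS := ae_shift omega aex; apply: (ae_imply2 aeS aeS) => t Ht _ t0.
  have t1 : 0 < t + omega by rewrite ltr_wpDr.
  have := Ht t1; rewrite !is_deriveP (pa _ (ltW t0)) (pb _ (ltW t0)) => H e /H [r r0 Hr].
  exists r => // y yt; have E : y - t = y + omega - (t + omega) by ring.
  by rewrite E; apply: Hr; rewrite -E.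
Qed.

Definition wronskian_pair x v y w t : R := x t * w t - v t * y t.

Hypothesis a_ac : loc_abs_continuous 0 a.

(** Extending [a] by the constant a(0) to the left gives a function continuous on the whole line
    with the same integrals over [0, t]. *)
Let alpha t : R := a (Num.max 0 t).

Lemma loc_abs_continuous_near s (f : R -> R) : loc_abs_continuous s f -> forall t, s <= t ->
  forall e : R, 0 < e -> exists2 r : R, 0 < r & forall y : R, s <= y -> `|y - t| < r -> `|f y - f t| < e.
Proof.
move=> acf t st e e0.
have ct : t <= t + 1 by lra.
have [r r0 Hr] := abs_continuous_continuous (acf s _ (lexx s) (le_trans st ct)) st ct e0.
exists (Num.min r 1); first by rewrite lt_min r0 ltr01.
move=> y sy; rewrite lt_min => /andP[yr y1]; apply: Hr => //.
by move: y1; rewrite ltr_norml => /andP[_]; lra.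
Qed.

Lemma damping_continuous : continuous alpha.
Proof.
apply: continuous_extend_left => d d0; apply: continuous_on_halfline.
exact: loc_abs_continuous_near a_ac.
Qed.

Lemma damping_lbm : locally_bounded_measurable alpha.
Proof. exact: lbm_continuous damping_continuous. Qed.

Lemma phase_pair_abs_continuous x v t : phase 0 x v -> 0 <= t -> abs_continuous_on 0 t x.
Proof.
move=> [dx acv _] t0; have acv0 := acv 0 t (lexx 0) t0.
have [M M0 HM] := continuous_on_bounded t0 (abs_continuous_continuous acv0).
apply: (@lipschitz_abs_continuous _ _ _ _ M) => u w u0 uw wt.
apply: (@halfline_derivative_lipschitz _ _ _ _ v) => // y uy yw; split.
  by apply: (halfline_derivativeS u0); apply: dx; exact: (le_trans u0 uy).
by apply: HM; lra.
Qed.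

Lemma is_derive_damping_exp t : 0 < t ->
  is_derive t 1 (fun s => expR (I alpha s)) (expR (I alpha t) * a t).
Proof.
move=> t0; have at0 : alpha t = a t by rewrite /alpha (max_idPr (ltW t0)).
rewrite -at0; apply: (is_derive1_comp (is_derive_expR _)).
apply/(halfline_derivative_is_derive _ _ t0).
apply: primitive_halfline_derivative => //; [exact: damping_lbm|exact: ltW|].
move=> e e0; have /cvgrPdist_lt /(_ e e0) /nbhs_ballP [d /= d0 Hd] := @damping_continuous t.
by exists d => // y _ yt; rewrite distrC; apply: Hd; rewrite /ball /= distrC.
Qed.

(** Convexity of the exponential: exp k - exp l <= exp k (k - l). *)
Lemma expR_lipschitz (B r s : R) : expR r <= B -> expR s <= B ->
  `|expR r - expR s| <= B * `|r - s|.
Proof.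
move=> rB sB.
have key (k l : R) : expR k <= B -> expR k - expR l <= B * `|k - l|.
  move=> kB; have := expR_ge1Dx (l - k).
  rewrite -(ler_pM2l (expR_gt0 k)) -expRD [k + _]addrC subrK => H.
  have k0 := expR_gt0 k; have n0 := normr_ge0 (k - l); have n1 := ler_norm (k - l).
  apply: (@le_trans _ _ (expR k * `|k - l|)); last by rewrite ler_wpM2r.
  apply: (@le_trans _ _ (expR k * (k - l))); last by rewrite ler_pM2l.
  by lra.
rewrite ler_norml; apply/andP; split; last exact: key.
by rewrite lerNl opprB distrC; exact: key.
Qed.

Lemma damping_exp_abs_continuous t : 0 <= t ->
  abs_continuous_on 0 t (fun s => expR (I alpha s)).
Proof.
move=> t0; have la := damping_lbm.
have [M HM] := la.2 t; have M0 : 0 <= M by apply: le_trans (HM t _) => //; rewrite ger0_norm.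
have [B B0 HB] : exists2 B, 0 < B & forall s, 0 <= s -> s <= t -> `|expR (I alpha s)| <= B.
  apply: continuous_on_bounded => // u u0 ut e e0.
  have cE : {for u, continuous (fun s => expR (I alpha s))}.
    apply: (@continuous_comp _ _ _ (I alpha) expR); first exact: primitive_continuous la u.
    exact: continuous_expR.
  have /cvgrPdist_lt /(_ e e0) /nbhs_ballP [d /= d0 Hd] := cE.
  by exists d => // y _ _ yt; rewrite distrC; apply: Hd; rewrite /ball /= distrC.
have HB' s : 0 <= s -> s <= t -> expR (I alpha s) <= B.
  by move=> s0 st; apply: le_trans (HB s s0 st); exact: ler_norm.
apply: (@lipschitz_abs_continuous _ _ _ _ (B * M)) => u w u0 uw wt.
have D : `|I alpha w - I alpha u| <= M * (w - u).
  apply: primitive_diff_le => // y uy yw; apply: HM.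
  by rewrite ger0_norm; lra.
have Bu := HB' u u0 (le_trans uw wt); have Bw := HB' w (le_trans u0 uw) wt.
rewrite -mulrA; apply: le_trans (expR_lipschitz Bw Bu) _.
by rewrite ler_pM2l.
Qed.

Lemma liouville x v y w t : phase 0 x v -> phase 0 y w -> 0 <= t ->
  wronskian_pair x v y w t = wronskian_pair x v y w 0 * expR (- I alpha t).
Proof.
(* In the derivative of [h] the terms with b cancel and the damping term is offset by the
   exponential. The coefficients 1 and -1 are written out to match the lemmas on linear
   combinations. *)
move=> Hx Hy t0; pose h s := (1 * (x s * w s) + -1 * (v s * y s)) * expR (I alpha s).
have hE s : h s = wronskian_pair x v y w s * expR (I alpha s).
  by rewrite /h /wronskian_pair mul1r mulN1r.
suff : h t = h 0.
  by rewrite !hE (primitive0 _ (lexx 0)) expR0 mulr1 => <-; rewrite -mulrA -expRD subrr expR0 mulr1.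
have acx := phase_pair_abs_continuous Hx t0; have acy := phase_pair_abs_continuous Hy t0.
have [dx acv aex] := Hx; have [dy acw aey] := Hy.
apply: (abs_continuous_ae_constant t0).
- apply: abs_continuousM => //; last exact: damping_exp_abs_continuous.
  by apply: abs_continuous_linear => //; apply: abs_continuousM => //; auto.
- apply: (ae_imply2 aex aey) => s Hv Hw s0.
  have Dx := (halfline_derivative_is_derive _ _ s0).1 (dx s (ltW s0)).
  have Dy := (halfline_derivative_is_derive _ _ s0).1 (dy s (ltW s0)).
  have D1 := is_deriveM Dx (Hw s0); have D2 := is_deriveM (Hv s0) Dy.
  have D := is_deriveM (is_derive_linear 1 (-1) D1 D2) (is_derive_damping_exp s0).
  have D' : is_derive s 1 h
    ((1 * (x s * w s) + -1 * (v s * y s)) * (expR (I alpha s) * a s) +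
     expR (I alpha s) *
     (1 * (x s * (- (a s * w s) - b s * y s) + w s * v s) +
      -1 * (v s * w s + y s * (- (a s * v s) - b s * x s)))) by exact: D.
  by apply: is_derive_eq; ring.
Qed.

(** Let D be z minus the candidate combination and E the same for derivatives. Both vanish at 0, so
    by [liouville] the Wronskians of x and of y with D vanish for all t. This is a linear system for
    (D, E) whose determinant is, up to sign, the nonzero Wronskian of x and y. *)
Lemma phase_pair_representation x v y w z u :
  phase 0 x v -> phase 0 y w -> phase 0 z u -> wronskian_pair x v y w 0 != 0 ->
  exists c d, [/\ z 0 = c * x 0 + d * y 0, u 0 = c * v 0 + d * w 0 &
    forall t, 0 <= t -> z t = c * x t + d * y t /\ u t = c * v t + d * w t].
Proof.
move=> Hx Hy Hz; set W := wronskian_pair x v y w 0 => W0.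
have W0' : x 0 * w 0 - v 0 * y 0 != 0 by exact: W0.
(* Cramer's rule for the initial values. *)
pose c := (z 0 * w 0 - u 0 * y 0) / W; pose d := (x 0 * u 0 - v 0 * z 0) / W.
have z0 : z 0 = c * x 0 + d * y 0.
  by rewrite /c /d /W /wronskian_pair; field.
have u0 : u 0 = c * v 0 + d * w 0.
  by rewrite /c /d /W /wronskian_pair; field.
exists c, d; split => // t t0.
have Hd := phase_pair_linear 1 (-1) Hz (phase_pair_linear c d Hx Hy).
have L1 := liouville Hx Hd t0; have L2 := liouville Hy Hd t0; have L := liouville Hx Hy t0.
have Wt : wronskian_pair x v y w t != 0 by rewrite L mulf_neq0 // gt_eqF // expR_gt0.
rewrite /wronskian_pair -z0 -u0 !mul1r !mulN1r !subrr !mulr0 subrr mul0r in L1 L2.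
set D := z t - (c * x t + d * y t) in L1 L2; set E := u t - (c * v t + d * w t) in L1 L2.
split; apply/eqP; rewrite -subr_eq0 -(mulrI_eq0 _ (mulfI Wt)) /wronskian_pair.
- have -> : (x t * w t - v t * y t) * (z t - (c * x t + d * y t)) =
    y t * (x t * E - v t * D) - x t * (y t * E - w t * D) by rewrite /D; ring.
  by rewrite L1 L2 !mulr0 subrr.
- have -> : (x t * w t - v t * y t) * (u t - (c * v t + d * w t)) =
    w t * (x t * E - v t * D) - v t * (y t * E - w t * D) by rewrite /E; ring.
  by rewrite L1 L2 !mulr0 subrr.
Qed.

Lemma phase_pair_exists omega p q : 0 < omega -> periodic_halfline omega a ->
  lebesgue_measurable_fun `[0, +oo[ b -> ess_bounded b ->
  exists x v, [/\ phase 0 x v, x 0 = p & v 0 = q].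
Proof.
move=> w0 pa bm bb; have [beta [M [mbeta betaM ab]]] := lebesgue_measurable_borel_version bm bb.
(* Periodicity makes the bound global; the contraction needs one constant for the whole
   half-line. *)
have [N HN] : bounded_halfline a.
  apply: periodic_continuous_bounded w0 pa _; apply: continuous_on_halfline.
  exact: loc_abs_continuous_near a_ac.
have lbeta : locally_bounded_measurable beta by split => // T; exists M.
pose K := Num.max M N.
have M0 : 0 <= M by exact: le_trans (betaM 0).
have [|||v [cv Hv]] := @phase_solution R alpha beta K p q damping_lbm lbeta.
- by rewrite le_max M0.
- by move=> t t0; rewrite le_max /alpha (max_idPr t0) HN ?orbT.
- by move=> t _; rewrite le_max betaM.
have lv := lbm_continuous cv.
pose x t := p + I v t.
pose f t := alpha t * v t + beta t * x t.
have lf : locally_bounded_measurable f by exact: lbm_picard_integrand damping_lbm lbeta _ lv.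
exists x, v; split.
- split.
  + move=> t t0; have HI : halfline_derivative 0 (I v) t (v t).
      apply: primitive_halfline_derivative => // e e0.
      have /cvgrPdist_lt /(_ e e0) /nbhs_ballP [d /= d0 Hd] := cv t.
      by exists d => // y _ yt; rewrite distrC; apply: Hd; rewrite /ball /= distrC.
    move=> e /HI [d d0 Hd]; exists d => // y y0 yd.
    by rewrite /x opprD addrACA subrr add0r; exact: Hd.
  + move=> c d c0 cd; have [B HB] := lf.2 d.
    apply: (@lipschitz_abs_continuous _ _ _ _ B) => r s cr rs sd.
    have Hvf u : v u = q - I f u by exact: Hv.
    have -> : v s - v r = - (I f s - I f r) by rewrite !Hvf; ring.
    rewrite normrN.
    apply: primitive_diff_le => //; first exact: le_trans cr.
    by move=> y ry ys; apply: HB; rewrite ger0_norm; lra.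
  (* Two null sets are discarded: where beta differs from b, and where the primitive fails to have
     derivative [f]. *)
  + have aeI := primitive_ae_derive lf; apply: (ae_imply2 ab aeI) => t bt It t0.
    have -> : v = (fun t => q - I f t) by apply/funext => s; rewrite Hv.
    have at0 : alpha t = a t by rewrite /alpha (max_idPr (ltW t0)).
    have := is_derive_linear 1 (-1) (is_derive_cst q t 1) (It t0).
    rewrite -Hv /f at0 bt ?ltW //.
    have -> : (fun u : R => 1 * cst q u + -1 * I f u) = (fun t => q - I f t).
      by apply/funext => s; rewrite mul1r mulN1r.
    congr is_derive; ring.
- by rewrite /x primitive0 // addr0.
- by rewrite Hv primitive0 // subr0.
Qed.

End PhasePairs.

(** * Floquet solutions *)

Section Floquet.
Context {R : realType}.
Variables (omega : R) (a b : R -> R).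
Hypotheses (omega_gt0 : 0 < omega) (a_ac : loc_abs_continuous 0 a)
  (b_meas : lebesgue_measurable_fun `[0, +oo[ b) (b_bnd : ess_bounded b)
  (a_per : periodic_halfline omega a) (b_per : periodic_halfline omega b)
  (osc : oscillatory a b) (zeros : no_zeros_at_distance a b (2 * omega)).
Implicit Types (s t c d : R) (x y z u v w : R -> R).
Notation phase := (phase_pair a b).
Notation I := (@primitive R).
Let alpha t : R := a (Num.max 0 t).
Let A : R := (\int[lebesgue_measure]_(t in `[0%R, omega]) a t)%R.

Lemma no_real_multiplier x v l : phase 0 x v -> nontrivial x ->
  (forall t, 0 <= t -> x (t + omega) = l * x t) -> False.
Proof.
move=> Hx nx Hl; have sx := phase_pair_solution Hx.
have [t [t0 _ xt0]] := osc sx nx 0.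
have tw : 0 <= t + omega by rewrite addr_ge0 // ltW.
apply: (zeros sx nx t0 _ xt0 _ (_ : t + omega + omega - t = 2 * omega)); last by ring.
- by rewrite addr_ge0 // ltW.
- by rewrite !Hl // xt0 !mulr0.
Qed.

Lemma integral_damping : I alpha omega = A.
Proof.
apply: eq_Rintegral => t; rewrite inE /= in_itv /= => /andP[t0 _].
by rewrite /alpha (max_idPr t0).
Qed.

(* With m + i n the eigenvalue of the monodromy matrix, y1 + i y2 is the
   corresponding complex Floquet solution. *)
Lemma floquet_pair : exists (x1 x2 y1 u1 y2 u2 : R -> R) (m n : R),
  [/\ solution_with_init a b 1 0 x1, solution_with_init a b 0 1 x2,
      [/\ x1 omega + deriv_halfline 0 x2 omega = 2 * m,
          wronskian x1 x2 omega = m ^+ 2 + n ^+ 2, 0 < n &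
          m ^+ 2 + n ^+ 2 = expR (- A)],
      phase 0 y1 u1 /\ phase 0 y2 u2 &
      [/\ forall t, 0 <= t -> y1 (t + omega) = m * y1 t - n * y2 t /\
                              u1 (t + omega) = m * u1 t - n * u2 t,
          forall t, 0 <= t -> y2 (t + omega) = m * y2 t + n * y1 t /\
                              u2 (t + omega) = m * u2 t + n * u1 t
        & wronskian_pair y1 u1 y2 u2 0 != 0]].
Proof.
have [x1 [v1 [H1 x10 v10]]] := phase_pair_exists a_ac 1 0 omega_gt0 a_per b_meas b_bnd.
have [x2 [v2 [H2 x20 v20]]] := phase_pair_exists a_ac 0 1 omega_gt0 a_per b_meas b_bnd.
have w0 := ltW omega_gt0.
have W0 : wronskian_pair x1 v1 x2 v2 0 = 1 by rewrite /wronskian_pair x10 v10 x20 v20; ring.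
have W0' : wronskian_pair x1 v1 x2 v2 0 != 0 by rewrite W0 oner_neq0.
have [c1 [d1 [e1 f1 S1]]] := phase_pair_representation a_ac H1 H2 (phase_pair_shift w0 a_per b_per H1) W0'.
have [c2 [d2 [e2 f2 S2]]] := phase_pair_representation a_ac H1 H2 (phase_pair_shift w0 a_per b_per H2) W0'.
(* The monodromy matrix now reads c1 = x1(omega), d1 = x1'(omega), c2 = x2(omega), d2 =
   x2'(omega). *)
rewrite x10 x20 v10 v20 !mulr0 !mulr1 !addr0 !add0r in e1 f1 e2 f2.
have WD : c1 * d2 - d1 * c2 = expR (- A).
  have := liouville a_ac H1 H2 w0; rewrite W0 mul1r integral_damping => <-.
  by rewrite /wronskian_pair e1 e2 f1 f2.
(* Otherwise x2 itself is an eigensolution with multiplier d2. Later c2 is the first coordinate of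
   the eigenvector and so guarantees that the eigensolution is nontrivial. *)
have c20 : c2 != 0.
  apply/eqP => c20; apply: (@no_real_multiplier x2 v2 d2 H2).
    apply: contrapT => nx; have z t : 0 <= t -> x2 t = 0.
      by move=> t0; apply: contrapT => xt; apply: nx; exists t.
    (* A function vanishing on the half-line cannot have slope 1 at 0; an error of 1/2 already shows
       it. *)
    have [dx _ _] := H2; have [|d d0 Hd] := dx 0 (lexx _) (1 / 2); first by lra.
    have dd : 0 <= d / 2 by lra.
    have := Hd (d / 2) dd; rewrite v20 !z // !subr0 mul1r sub0r normrN (ger0_norm dd).
    by move=> H; have := H ltac:(lra); lra.
  by move=> t t0; have [-> _] := S2 t t0; rewrite c20 mul0r add0r.
(* The strict inequality also excludes a double root. For a real root l the eigensolution is c2 x1 +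
   (l - c1) x2, with value c2 at 0. *)
have disc : (c1 + d2) ^+ 2 < 4 * expR (- A).
  rewrite ltNge; apply/negP => D0.
  pose q := Num.sqrt ((c1 + d2) ^+ 2 - 4 * expR (- A)).
  have q2 : q ^+ 2 = (c1 + d2) ^+ 2 - 4 * (c1 * d2 - d1 * c2).
    by rewrite sqr_sqrtr ?WD // subr_ge0.
  pose l := (c1 + d2 + q) / 2.
  have lE : l ^+ 2 - (c1 + d2) * l + (c1 * d2 - d1 * c2) = 0.
    have -> : l ^+ 2 - (c1 + d2) * l + (c1 * d2 - d1 * c2) =
      (q ^+ 2 - ((c1 + d2) ^+ 2 - 4 * (c1 * d2 - d1 * c2))) / 4 by rewrite /l; field.
    by rewrite q2 subrr mul0r.
  apply: (@no_real_multiplier (fun t => c2 * x1 t + (l - c1) * x2 t) _ l (phase_pair_linear c2 (l - c1) H1 H2)).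
    by exists 0; split => //; rewrite x10 x20 mulr1 mulr0 addr0; apply/eqP.
  move=> t t0; have [-> _] := S1 t t0; have [-> _] := S2 t t0.
  apply/eqP; rewrite -subr_eq0; apply/eqP.
  transitivity (- x2 t * (l ^+ 2 - (c1 + d2) * l + (c1 * d2 - d1 * c2))); first ring.
  by rewrite lE mulr0.
pose m := (c1 + d2) / 2; pose n := Num.sqrt (expR (- A) - m ^+ 2).
have mm : 0 < expR (- A) - m ^+ 2 by rewrite /m; move: disc; nra.
have n0 : 0 < n by rewrite sqrtr_gt0.
have n2 : m ^+ 2 + n ^+ 2 = expR (- A) by rewrite sqr_sqrtr ?ltW //; ring.
have n2' : n ^+ 2 = (c1 * d2 - d1 * c2) - m ^+ 2 by rewrite WD -n2; ring.
have Ed2 : d2 = 2 * m - c1 by rewrite /m; field.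
(* Real and imaginary parts of the same eigensolution with l = m + i n; the zero coefficients keep
   the shape of [phase_pair_linear]. *)
pose y1 t := c2 * x1 t + (m - c1) * x2 t; pose u1 t := c2 * v1 t + (m - c1) * v2 t.
pose y2 t := 0 * x1 t + n * x2 t; pose u2 t := 0 * v1 t + n * v2 t.
have D2w := phase_pair_deriv H2 w0; have D1w := phase_pair_deriv H1 w0.
exists x1, x2, y1, u1, y2, u2, m, n; split.
- by split; [exact: phase_pair_solution H1|exact: x10|rewrite (phase_pair_deriv H1 (lexx 0))].
- by split; [exact: phase_pair_solution H2|exact: x20|rewrite (phase_pair_deriv H2 (lexx 0))].
- split => //; first by rewrite D2w e1 f2 /m; field.
  by rewrite /wronskian D1w D2w e1 e2 f1 f2 n2 -WD.
- by split; exact: phase_pair_linear.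
(* One identity serves the solutions and their derivatives alike. *)
- have key (p1 p2 : R) :
    c2 * (c1 * p1 + d1 * p2) + (m - c1) * (c2 * p1 + d2 * p2) =
    m * (c2 * p1 + (m - c1) * p2) - n * (0 * p1 + n * p2).
    apply/eqP; rewrite -subr_eq0; apply/eqP.
    transitivity (p2 * (n ^+ 2 - ((c1 * d2 - d1 * c2) - m ^+ 2))).
      by rewrite Ed2; ring.
    by rewrite n2' subrr mulr0.
  split.
  + move=> t t0; have [A1 B1] := S1 t t0; have [A2 B2] := S2 t t0.
    by rewrite /y1 /u1 /y2 /u2 A1 A2 B1 B2 !key.
  + move=> t t0; have [A1 B1] := S1 t t0; have [A2 B2] := S2 t t0.
    by rewrite /y1 /u1 /y2 /u2 A1 A2 B1 B2 Ed2; split; ring.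
  + rewrite /wronskian_pair /y1 /u1 /y2 /u2 x10 x20 v10 v20.
    have -> : (c2 * 1 + (m - c1) * 0) * (0 * 0 + n * 1) - (c2 * 0 + (m - c1) * 1) * (0 * 1 + n * 0) = c2 * n.
      by ring.
    by rewrite mulf_neq0 // gt_eqF.
Qed.

(** The mean damping: Wronskians behave like exp(- kappa t), single solutions like its square
    root. *)
Let kappa := A / omega.

Let kappa_omega : kappa * omega = A.
Proof. by rewrite /kappa divfK // gt_eqF. Qed.

Lemma floquet_bound (y1 u1 y2 u2 : R -> R) (m n : R) :
  m ^+ 2 + n ^+ 2 = expR (- A) -> phase 0 y1 u1 -> phase 0 y2 u2 ->
  (forall t, 0 <= t -> y1 (t + omega) = m * y1 t - n * y2 t) ->
  (forall t, 0 <= t -> y2 (t + omega) = m * y2 t + n * y1 t) ->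
  exists2 N, 0 <= N & forall t, 0 <= t ->
    `|y1 t| <= N * expR (- (kappa / 2 * t)) /\ `|y2 t| <= N * expR (- (kappa / 2 * t)).
Proof.
move=> mn H1 H2 S1 S2.
pose S t := (y1 t * y1 t + y2 t * y2 t) * expR (kappa * t).
have Sper : periodic_halfline omega S.
  move=> t t0; rewrite /S S1 // S2 //.
  have -> : kappa * (t + omega) = kappa * t + A by rewrite mulrDr kappa_omega.
  rewrite expRD.
  have -> : (m * y1 t - n * y2 t) * (m * y1 t - n * y2 t) +
    (m * y2 t + n * y1 t) * (m * y2 t + n * y1 t) =
    (m ^+ 2 + n ^+ 2) * (y1 t * y1 t + y2 t * y2 t) by ring.
  rewrite mn expRN; have := gt_eqF (expR_gt0 A) => /negbT A0.
  by field.
have Sc : continuous_on 0 omega S.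
  have w0 := ltW omega_gt0.
  have ac1 := phase_pair_abs_continuous H1 w0; have ac2 := phase_pair_abs_continuous H2 w0.
  apply: abs_continuous_continuous; apply: abs_continuousM => //.
    by apply: abs_continuousD; apply: abs_continuousM.
  have Hk t : 0 <= t -> t <= omega -> expR (kappa * t) <= expR (`|kappa| * omega).
    move=> t0 tw; rewrite ler_expR; apply: (@le_trans _ _ (`|kappa| * t)).
      by rewrite ler_wpM2r // ler_norm.
    by rewrite ler_wpM2l.
  apply: (@lipschitz_abs_continuous _ _ _ _ (expR (`|kappa| * omega) * `|kappa|)) => s t s0 st tw.
  apply: le_trans (expR_lipschitz (Hk t (le_trans s0 st) tw) (Hk s s0 (le_trans st tw))) _.
  have -> : kappa * t - kappa * s = kappa * (t - s) by ring.
  have ts : 0 <= t - s by rewrite subr_ge0.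
  by rewrite (normrM kappa (t - s)) mulrA (ger0_norm ts).
have [M HM] := periodic_continuous_bounded omega_gt0 Sper Sc.
have M0 : 0 <= M by exact: le_trans (HM 0 (lexx _)).
exists (Num.sqrt M); first exact: sqrtr_ge0.
move=> t t0.
have E2 : expR (- (kappa / 2 * t)) ^+ 2 * expR (kappa * t) = 1.
  rewrite expr2 -!expRD; have -> : - (kappa / 2 * t) - kappa / 2 * t + kappa * t = 0 by field.
  exact: expR0.
have E0 := expR_gt0 (- (kappa / 2 * t)); have K0 := expR_gt0 (kappa * t).
have bound (z1 z2 : R) : (z1 * z1 + z2 * z2) * expR (kappa * t) <= M ->
    `|z1| <= Num.sqrt M * expR (- (kappa / 2 * t)).
  move=> Hz; have P0 : 0 <= Num.sqrt M * expR (- (kappa / 2 * t)).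
    by apply: mulr_ge0; [exact: sqrtr_ge0|exact: ltW].
  rewrite -(ler_pXn2r (ltn0Sn 1)) ?nnegrE // real_normK ?num_real // exprMn sqr_sqrtr //.
  rewrite -(ler_pM2r K0) -(mulrA M) E2 mulr1; apply: le_trans Hz.
  by rewrite (ler_pM2r K0) -!expr2 lerDl sqr_ge0.
have := HM t t0; rewrite ger0_norm /S => [HS|]; last first.
  by rewrite mulr_ge0 ?(ltW K0) // addr_ge0 // -expr2 sqr_ge0.
by split; [exact: bound HS|apply: (bound _ (y1 t)); rewrite addrC].
Qed.

(** One period multiplies the Wronskian by m^2 + n^2 = exp(- A), so exp(- kappa t) / W(t) is
    periodic. Liouville's formula supplies the continuity that bounds it over one period. *)
Lemma floquet_wronskian_bound (y1 u1 y2 u2 : R -> R) (m n : R) :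
  m ^+ 2 + n ^+ 2 = expR (- A) -> phase 0 y1 u1 -> phase 0 y2 u2 ->
  (forall t, 0 <= t -> y1 (t + omega) = m * y1 t - n * y2 t /\
                       u1 (t + omega) = m * u1 t - n * u2 t) ->
  (forall t, 0 <= t -> y2 (t + omega) = m * y2 t + n * y1 t /\
                       u2 (t + omega) = m * u2 t + n * u1 t) ->
  wronskian_pair y1 u1 y2 u2 0 != 0 ->
  exists2 N, 0 <= N & forall t, 0 <= t ->
    `|(wronskian_pair y1 u1 y2 u2 t)^-1| <= N * expR (kappa * t).
Proof.
move=> mn H1 H2 S1 S2 W0.
have L t (t0 : 0 <= t) := liouville a_ac H1 H2 t0.
set W := wronskian_pair y1 u1 y2 u2 in W0 L *.
have Wt t : 0 <= t -> W t != 0.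
  by move=> t0; rewrite L // mulf_neq0 // gt_eqF // expR_gt0.
pose S t := (W t)^-1 * expR (- kappa * t).
have Sper : periodic_halfline omega S.
  move=> t t0; rewrite /S.
  have -> : - kappa * (t + omega) = - kappa * t - A by rewrite mulrDr !mulNr kappa_omega.
  rewrite expRD -mn.
  have -> : W (t + omega) = (m ^+ 2 + n ^+ 2) * W t.
    by rewrite /W /wronskian_pair; have [-> ->] := S1 t t0; have [-> ->] := S2 t t0; ring.
  have mn0 : m ^+ 2 + n ^+ 2 != 0 by rewrite mn gt_eqF // expR_gt0.
  have := Wt t t0 => Wt0; by field; rewrite Wt0 mn0.
have Sc : continuous_on 0 omega S.
  pose f t := (W 0)^-1 * (expR (I alpha t) * expR (- kappa * t)).
  have SE t : 0 <= t -> S t = f t.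
    move=> t0; rewrite /S L // expRN invfM invrK /f mulrA //.
  have cf : continuous f.
    have cI : continuous (fun t => expR (I alpha t)).
      move=> t; apply: (@continuous_comp _ _ _ (I alpha) expR); last exact: continuous_expR.
      exact: primitive_continuous (damping_lbm a_ac) t.
    move=> t; apply: cvgM; first exact: cvg_cst.
    by apply: cvgM; [exact: cI|exact: expR_scale_continuous].
  move=> t t0 tw e e0; have /cvgrPdist_lt /(_ e e0) /nbhs_ballP [d /= d0 Hd] := @cf t.
  exists d => // y y0 _ yt; rewrite !SE // distrC; apply: Hd.
  by rewrite /ball /= distrC.
have [M HM] := periodic_continuous_bounded omega_gt0 Sper Sc.
exists M; first exact: le_trans (HM 0 (lexx _)).
move=> t t0; have := HM t t0; rewrite /S normrM (gtr0_norm (expR_gt0 _)).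
rewrite -(ler_pM2r (expR_gt0 (kappa * t))) -mulrA -expRD mulNr addNr expR0 mulr1.
exact.
Qed.

End Floquet.

(** * Independence, normal form and stability from the Floquet pair *)

Section FloquetConsequences.
Context {R : realType}.
Variables (omega : R) (a b : R -> R).
Hypothesis omega_gt0 : 0 < omega.
Implicit Types (s t c d : R) (x y z u v w : R -> R).
Notation phase := (phase_pair a b).

Lemma wronskian_pair_free y1 u1 y2 u2 : phase 0 y1 u1 -> phase 0 y2 u2 ->
  wronskian_pair y1 u1 y2 u2 0 != 0 -> forall c1 c2 : R,
  (forall t, 0 <= t -> c1 * y1 t + c2 * y2 t = 0) -> c1 = 0 /\ c2 = 0.
Proof.
move=> H1 H2 W0 c1 c2 Hc.
have Hz := phase_pair_linear c1 c2 H1 H2.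
have yz := Hc 0 (lexx _).
(* The combination vanishes on [0, +oo[, hence so does its one-sided derivative at 0. *)
have uz : c1 * u1 0 + c2 * u2 0 = 0.
  rewrite -(phase_pair_deriv Hz (lexx 0)); apply: halfline_derivative_deriv => // e e0.
  exists 1 => // y y0 _; rewrite !Hc // mul0r !subrr normr0.
  by apply: mulr_ge0 => //; exact: ltW.
have W0' : y1 0 * u2 0 - u1 0 * y2 0 != 0 by exact: W0.
split; apply/eqP; rewrite -(mulrI_eq0 _ (mulfI W0')); apply/eqP.
- transitivity (u2 0 * (c1 * y1 0 + c2 * y2 0) - y2 0 * (c1 * u1 0 + c2 * u2 0)); first by ring.
  by rewrite yz uz !mulr0 subrr.
- transitivity (y1 0 * (c1 * u1 0 + c2 * u2 0) - u1 0 * (c1 * y1 0 + c2 * y2 0)); first by ring.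
  by rewrite yz uz !mulr0 subrr.
Qed.

(** In the upper half-plane the arc cosine alone determines the angle, its sine being
    nonnegative. *)
Lemma polar_angle (m n : R) : 0 < n ->
  exists th, m = Num.sqrt (m ^+ 2 + n ^+ 2) * cos th /\ n = Num.sqrt (m ^+ 2 + n ^+ 2) * sin th.
Proof.
move=> n0; set rho := Num.sqrt _.
have q0 : 0 < m ^+ 2 + n ^+ 2 by rewrite ltr_wpDl ?sqr_ge0 // exprn_gt0.
have rho0 : 0 < rho by rewrite sqrtr_gt0.
have rho2 : rho ^+ 2 = m ^+ 2 + n ^+ 2 by rewrite sqr_sqrtr // ltW.
have rhoN : rho != 0 by rewrite gt_eqF.
have mrho : -1 <= m / rho <= 1.
  rewrite ler_pdivlMr // ler_pdivrMr // mulN1r mul1r.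
  by apply/andP; split; nra.
exists (acos (m / rho)); rewrite acosK // sin_acos //; split.
  by rewrite mulrC divfK.
have -> : 1 - (m / rho) ^+ 2 = (n / rho) ^+ 2.
  by rewrite !expr_div_n rho2; field; rewrite gt_eqF.
by rewrite sqrtr_sqr gtr0_norm ?divr_gt0 // mulrC divfK.
Qed.

(* Real and imaginary parts of g1 + i g2 = (y1 + i y2) exp(- i th t / omega) rho^(- t / omega). *)
Lemma floquet_normal_form (m n rho th : R) (y1 y2 : R -> R) : 0 < rho ->
  m = rho * cos th -> n = rho * sin th ->
  (forall t, 0 <= t -> y1 (t + omega) = m * y1 t - n * y2 t) ->
  (forall t, 0 <= t -> y2 (t + omega) = m * y2 t + n * y1 t) ->
  exists g1 g2, [/\ periodic_halfline omega g1, periodic_halfline omega g2,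
    forall t, (g1 t * cos (th * t / omega) - g2 t * sin (th * t / omega)) *
      expR (ln rho / omega * t) = y1 t &
    forall t, (g2 t * cos (th * t / omega) + g1 t * sin (th * t / omega)) *
      expR (ln rho / omega * t) = y2 t].
Proof.
move=> rho0 mE nE S1 S2.
pose E t := expR (- (ln rho / omega * t)).
have EE t : E t * expR (ln rho / omega * t) = 1 by rewrite -expRD addNr expR0.
have w0 : omega != 0 by rewrite gt_eqF.
have rhoN : rho != 0 by rewrite gt_eqF.
have Ew t : E (t + omega) = E t / rho.
  rewrite /E mulrDr (divfK w0) opprD expRD; congr (_ * _).
  by rewrite expRN lnK.
have thw t : th * (t + omega) / omega = th * t / omega + th by field.
exists (fun t => (y1 t * cos (th * t / omega) + y2 t * sin (th * t / omega)) * E t),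
  (fun t => (y2 t * cos (th * t / omega) - y1 t * sin (th * t / omega)) * E t); split.
- move=> t t0; rewrite Ew S1 // S2 // thw cosD sinD mE nE.
  have := cos2Dsin2 th; set C := cos th; set S := sin th.
  set c := cos _; set s := sin _ => CS.
  transitivity ((C ^+ 2 + S ^+ 2) * ((y1 t * c + y2 t * s) * E t)); first by field.
  by rewrite CS mul1r.
- move=> t t0; rewrite Ew S1 // S2 // thw cosD sinD mE nE.
  have := cos2Dsin2 th; set C := cos th; set S := sin th.
  set c := cos _; set s := sin _ => CS.
  transitivity ((C ^+ 2 + S ^+ 2) * ((y2 t * c - y1 t * s) * E t)); first by field.
  by rewrite CS mul1r.
- move=> t; have := cos2Dsin2 (th * t / omega).
  set c := cos _; set s := sin _ => CS; have Et := EE t; set F := expR _ in Et *.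
  transitivity ((c ^+ 2 + s ^+ 2) * (y1 t * (E t * F))); first by ring.
  by rewrite CS Et mul1r mulr1.
- move=> t; have := cos2Dsin2 (th * t / omega).
  set c := cos _; set s := sin _ => CS; have Et := EE t; set F := expR _ in Et *.
  transitivity ((c ^+ 2 + s ^+ 2) * (y2 t * (E t * F))); first by ring.
  by rewrite CS Et mul1r mulr1.
Qed.

Lemma floquet_exponentially_stable kappa (y1 u1 y2 u2 : R -> R) (N N' : R) : 0 < kappa ->
  loc_abs_continuous 0 a -> phase 0 y1 u1 -> phase 0 y2 u2 ->
  wronskian_pair y1 u1 y2 u2 0 != 0 -> 0 <= N -> 0 <= N' ->
  (forall t, 0 <= t -> `|y1 t| <= N * expR (- (kappa / 2 * t)) /\
                       `|y2 t| <= N * expR (- (kappa / 2 * t))) ->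
  (forall t, 0 <= t -> `|(wronskian_pair y1 u1 y2 u2 t)^-1| <= N' * expR (kappa * t)) ->
  exponentially_stable a b.
Proof.
move=> k0 a_ac H1 H2 W0 N0 N'0 HN HW.
set W := wronskian_pair y1 u1 y2 u2 in W0 HW.
have Wt t : 0 <= t -> W t != 0.
  by move=> t0; rewrite /W (liouville a_ac H1 H2 t0) mulf_neq0 // gt_eqF // expR_gt0.
(* The combination of y1 and y2 vanishing at s, divided by W(s) so that its slope there is 1. *)
pose X t s := - (y2 s / W s) * y1 t + y1 s / W s * y2 t.
exists X; split.
  move=> s s0.
  have HX := phase_pairS s0 (phase_pair_linear (- (y2 s / W s)) (y1 s / W s) H1 H2).
  split; first exact: phase_pair_solution HX.
    by rewrite /X; ring.
  rewrite (phase_pair_deriv HX (lexx s)).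
  transitivity (W s / W s); first by rewrite /W /wronskian_pair; ring.
  by rewrite divff // Wt.
(* Each of the two terms of [X] contributes N^2 N'; the summand 1 makes K positive. *)
exists (2 * N ^+ 2 * N' + 1), (kappa / 2); split; first by rewrite ltr_wpDl // !mulr_ge0 ?sqr_ge0.
  by rewrite divr_gt0.
move=> t s s0 st; have t0 := le_trans s0 st.
have [Y1s Y2s] := HN s s0; have [Y1t Y2t] := HN t t0; have Ws := HW s s0.
set es := expR (- (kappa / 2 * s)) in Y1s Y2s; set et := expR (- (kappa / 2 * t)) in Y1t Y2t.
set ks := expR (kappa * s) in Ws.
have E : es * et * ks = expR (- (kappa / 2) * (t - s)).
  by rewrite -!expRD; congr expR; field.
have pos (p q r : R) : `|p| <= N * es -> `|q| <= N * et -> `|r| <= N' * ks ->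
    `|p * r * q| <= N ^+ 2 * N' * (es * et * ks).
  move=> Hp Hq Hr; rewrite !normrM.
  have -> : N ^+ 2 * N' * (es * et * ks) = (N * es) * (N' * ks) * (N * et) by ring.
  by do 2?apply: ler_pM => //.
have B1 := pos _ _ _ Y2s Y1t Ws; have B2 := pos _ _ _ Y1s Y2t Ws.
rewrite E in B1 B2; have E0 := expR_gt0 (- (kappa / 2) * (t - s)).
apply: le_trans (ler_normD _ _) _; rewrite mulNr normrN.
by apply: le_trans (lerD B1 B2) _; nra.
Qed.

End FloquetConsequences.
Theorem theorem11 (R : realType) (omega : R) (a b : R -> R)
  (omega_gt0 : 0 < omega)
  (a_ac : loc_abs_continuous 0 a)
  (b_meas : lebesgue_measurable_fun `[0, +oo[ b)
  (b_bnd : ess_bounded b)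
  (a_per : periodic_halfline omega a)
  (b_per : periodic_halfline omega b)
  (osc : oscillatory a b)
  (zeros : no_zeros_at_distance a b (2 * omega)) :
  let A := (\int[lebesgue_measure]_(t in `[0, omega]) a t)%R in
  [/\ 0 < A -> exponentially_stable a b,
      A < 0 ->
        exists (lambda1 : R[i]) (theta : R) (g1 g2 : R -> R),
        [/\ characteristic_root a b omega lambda1,
            lambda1 = (modulus lambda1)%:C * cexp_i theta,
            1 < modulus lambda1,
            periodic_halfline omega g1 /\ periodic_halfline omega g2 &
            fundamental_pair a b
              (fun t => (g1 t * cos (theta * t / omega)
                         - g2 t * sin (theta * t / omega))
                        * expR (ln (modulus lambda1) / omega * t))
              (fun t => (g2 t * cos (theta * t / omega)
                         + g1 t * sin (theta * t / omega))
                        * expR (ln (modulus lambda1) / omega * t))] &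
      A = 0 -> forall y1 y2 : R -> R, fundamental_pair a b y1 y2 ->
        bounded_halfline y1 /\ bounded_halfline y2].
Proof.
move=> A.
have [x1 [x2 [y1 [u1 [y2 [u2 [m [n [Hx1 Hx2 [tr det n0 mn] [H1 H2] [S1 S2 W0]]]]]]]]]] :=
  floquet_pair omega_gt0 a_ac b_meas b_bnd a_per b_per osc zeros.
have S1' t t0 := (S1 t t0).1; have S2' t t0 := (S2 t t0).1.
have [N N0 HN] := floquet_bound omega_gt0 mn H1 H2 S1' S2'.
split.
- move=> A0.
  have [N' N'0 HW] := floquet_wronskian_bound omega_gt0 a_ac mn H1 H2 S1 S2 W0.
  exact: floquet_exponentially_stable (divr_gt0 A0 omega_gt0) a_ac H1 H2 W0 N0 N'0 HN HW.
- move=> A0; have mn1 : 1 < m ^+ 2 + n ^+ 2 by rewrite mn expR_gt1 oppr_gt0.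
  pose rho := Num.sqrt (m ^+ 2 + n ^+ 2).
  have rho1 : 1 < rho by rewrite -sqrtr1 ltr_sqrt // (lt_trans ltr01).
  have rho0 : 0 < rho by exact: lt_trans ltr01 rho1.
  have [th [mE nE]] := polar_angle m n0.
  have [g1 [g2 [p1 p2 E1 E2]]] := floquet_normal_form omega_gt0 rho0 mE nE S1' S2'.
  have rhoE : modulus (m +i* n) = rho by [].
  exists (m +i* n), th, g1, g2; rewrite rhoE; split => //.
  (* The trace is 2 m and the determinant m^2 + n^2, the sum and product of m + i n and its
     conjugate. *)
  + exists x1, x2; split => //; rewrite tr det.
    by apply/eqP; rewrite eq_complex /=; apply/andP; split; apply/eqP; ring.
  + apply/eqP; rewrite eq_complex /= !mul0r subr0 addr0.
    by apply/andP; split; apply/eqP; [exact: mE|exact: nE].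
  + have -> : (fun t => (g1 t * cos (th * t / omega) - g2 t * sin (th * t / omega)) *
      expR (ln rho / omega * t)) = y1 by apply/funext.
    have -> : (fun t => (g2 t * cos (th * t / omega) + g1 t * sin (th * t / omega)) *
      expR (ln rho / omega * t)) = y2 by apply/funext.
    split; [exact: phase_pair_solution H1|exact: phase_pair_solution H2|].
    exact: wronskian_pair_free H1 H2 W0.
- move=> A0 z1 z2 [s1 s2 _].
  (* Every solution is a combination of y1 and y2, and for mean zero the weight in [floquet_bound]
     is 1. *)
  have bnd z : is_solution a b 0 z -> bounded_halfline z.
    move=> /solution_phase_pair Hz.
    have [c [d [_ _ Hcd]]] := phase_pair_representation a_ac H1 H2 Hz W0.
    exists (`|c| * N + `|d| * N) => t t0; have [-> _] := Hcd t t0.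
    have := HN t t0; rewrite -/A A0 !mul0r oppr0 expR0 mulr1 => -[B1 B2].
    apply: le_trans (ler_normD _ _) _; rewrite !normrM.
    by apply: lerD; apply: ler_wpM2l.
  by split; exact: bnd.
Qed.
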